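(* Let $f$ be a monotone twist map with twist interval $(\omega_-,\omega_+)$ and generating function $H$, and let $T_{p,q}$ denote the minimal action of $(p,q)$-periodic sequences, as defined in the context. For all relatively prime $(p,q)\in\mathbb{Z}\times\mathbb{Z}_+$ with $\frac pq\in(\omega_-,\omega_+)$ and $q\neq 1$, the inequality $$T_{p,q-1}+T_{p,q+1}>2\,T_{p,q}$$ holds.
   Context: Let $S^1=\mathbb{R}/\mathbb{Z}$ and $-\infty\le a<b\le+\infty$. A monotone twist map is a diffeomorphism $f:S^1\times(a,b)\to S^1\times(a,b)$, isotopic to the identity, preserving the area form $dy\wedge dx$, with a lift $F=(F_1,F_2):\mathbb{R}\times(a,b)\to\mathbb{R}\times(a,b)$ satisfying $\frac{\partial F_1}{\partial y}(x,y)>0$. If $a$ (resp. $b$) is finite, $F$ is assumed to extend to the boundary of the strip as a rigid shift, $F(x,a)=(x+\omega_-,a)$ (resp. $F(x,b)=(x+\omega_+,b)$); otherwise $\omega_-:=-\infty$ (resp. $\omega_+:=+\infty$). The interval $(\omega_-,\omega_+)$ is called the twist interval. A generating function for $f$ is a function $H:\{(x,x')\in\mathbb{R}^2:\omega_-<x'-x<\omega_+\}\to\mathbb{R}$ such that $F(x,y)=(x',y')$ if and only if $\frac{\partial H}{\partial x}(x,x')=-y$ and $\frac{\partial H}{\partial x'}(x,x')=y'$. It satisfies $H(x+k,x'+k)=H(x,x')$ for $k\in\mathbb{Z}$, and the twist condition becomes $\frac{\partial^2H}{\partial x\,\partial x'}<0$. $T_{p,q}$ denotes the minimal value of $$H(x_0,x_1)+H(x_1,x_2)+\dots+H(x_{q-1},x_q)$$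 on the space of bi-infinite sequences of real numbers $(x_n)_{n\in\mathbb{Z}}$ satisfying the monotonicity condition $x_{n+1}\ge x_n$ and the periodicity condition $x_{n+q}=x_n+p$ for all $n$. In this definition $p$ and $q$ need not be relatively prime.
   Formalization: The formal theorem also assumes that (p,q)-periodic monotone sequences exist, i.e. p ≥ 0: for p < 0 the conditions x_{n+1} ≥ x_n and x_{n+q} = x_n + p are incompatible, so T_{p,q} is undefined. A T with no admissible sequence counts as +∞. *)

(* Defs.v *)
From HB Require Import structures.
From mathcomp Require Import all_boot all_order all_algebra.
From mathcomp Require Import all_classical all_reals all_analysis.
Set Implicit Arguments.
Unset Strict Implicit.
Unset Printing Implicit Defensive.
Import Order.TTheory GRing.Theory Num.Theory.
Import numFieldNormedType.Exports.
Local Open Scope classical_set_scope.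
Local Open Scope ring_scope.

Section TwistMaps.
Context {R : realType}.
Implicit Types (a b wm wp : \bar R) (F : R * R -> R * R) (H : R -> R -> R).

Definition strip a b : set (R * R) := [set z | (a < z.2%:E < b)%E].

(* In finite dimension, continuity of the differential is tested on vectors. *)
Definition C1_on (A : set (R * R)) F : Prop :=
  forall z, A z ->
    differentiable F z /\
    forall v, {for z, continuous (fun w => 'd F w v)}.

(* Maps of S^1 x (a,b), with S^1 = R/Z, are represented by their lifts to the
   strip R x (a,b); values off the strip are irrelevant.  Since all the maps
   considered are isotopic to the identity, their lifts commute with the deck
   translation (x, y) |-> (x + 1, y). *)
Definition annulus_diffeo a b F : Prop :=
  [/\ forall x y, strip a b (x, y) -> F (x + 1, y) = F (x, y) + (1, 0),
      forall z, strip a b z -> strip a b (F z),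
      C1_on (strip a b) F &
      exists G, [/\ forall z, strip a b z -> strip a b (G z),
                    C1_on (strip a b) G,
                    forall z, strip a b z -> G (F z) = z &
                    forall z, strip a b z -> F (G z) = z]].

(* Any two lifts of f differ by an integer translation (x, y) |-> (x + k, y),
   itself isotopic to the identity through the maps (x, y) |-> (x + t k, y), so
   that f is isotopic to the identity iff any of its lifts is. *)
Definition isotopic_to_id a b F : Prop :=
  exists Phi : R -> R * R -> R * R,
    [/\ forall t, 0 <= t <= 1 -> annulus_diffeo a b (Phi t),
        {within [set tz : R * (R * R) | 0 <= tz.1 <= 1 /\ strip a b tz.2],
           continuous (fun tz => Phi tz.1 tz.2)},
        forall z, strip a b z -> Phi 0 z = z &
        forall z, strip a b z -> Phi 1 z = F z].

(* The form dy /\ dx on tangent vectors. *)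
Definition area_form (u v : R * R) : R := u.2 * v.1 - u.1 * v.2.

Definition area_preserving a b F : Prop :=
  forall z u v, strip a b z ->
    area_form ('d F z u) ('d F z v) = area_form u v.

Definition twist_condition a b F : Prop :=
  forall x y, strip a b (x, y) -> 0 < derive1 (fun s => (F (x, s)).1) y.

(* [boundary_shift a b F e w dflt]: behaviour at an end [e] (= a or b) of the
   strip.  If [e] is finite, F extends continuously to the line y = e by
   (x, e) |-> (x + w, e); otherwise w is the default infinite value. *)
Definition boundary_shift a b F (e w dflt : \bar R) : Prop :=
  if e is r%:E then
    exists2 s : R, w = s%:E &
      forall x, F z @[z --> within (strip a b) (nbhs (x, r))] --> (x + s, r)
  else w = dflt.

(* F is a lift of a monotone twist map of S^1 x (a,b), with twist interval
   (wm, wp). *)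
Definition monotone_twist_map a b wm wp F : Prop :=
  (a < b)%E /\
  [/\ annulus_diffeo a b F, isotopic_to_id a b F,
      area_preserving a b F & twist_condition a b F] /\
  boundary_shift a b F a wm -oo%E /\
  boundary_shift a b F b wp +oo%E.

Definition gen_domain wm wp (x x' : R) : Prop := (wm < (x' - x)%:E < wp)%E.

(* H is a total function of which only the restriction to [gen_domain] matters.
   The inequality d^2 H / dx dx' < 0 follows from [twist_condition] and is not
   repeated.  Periodicity is not automatic when (a,b) is the whole line. *)
Definition generating_function a b wm wp F H : Prop :=
  [/\ forall x x', gen_domain wm wp x x' ->
        differentiable (fun z : R * R => H z.1 z.2) (x, x'),
      forall x y x' y',
        (strip a b (x, y) /\ F (x, y) = (x', y')) <->
        [/\ gen_domain wm wp x x',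
            derive1 (H^~ x') x = - y & derive1 (H x) x' = y'] &
      forall (k : int) x x', gen_domain wm wp x x' ->
        H (x + k%:~R) (x' + k%:~R) = H x x'].

(* The last condition says that the action below is defined. *)
Definition pq_sequences wm wp (p : int) (q : nat) : set (int -> R) :=
  [set x | [/\ forall n, x n <= x (n + 1),
               forall n, x (n + q%:Z) = x n + p%:~R &
               forall n, gen_domain wm wp (x n) (x (n + 1))]].

Definition action H (q : nat) (x : int -> R) : R :=
  \sum_(i < q) H (x i%:Z) (x (i%:Z + 1)).

(* T_{p,q}, equal to +oo when there is no sequence to minimize over. *)
Definition min_action wm wp H (p : int) (q : nat) : \bar R :=
  ereal_inf [set (action H q x)%:E | x in pq_sequences wm wp p q].

Lemma min_actionE wm wp H p q x :
  pq_sequences wm wp p q x ->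
  (forall y, pq_sequences wm wp p q y -> action H q x <= action H q y) ->
  min_action wm wp H p q = (action H q x)%:E.
Proof.
move=> xS xmin; apply/eqP; rewrite eq_le; apply/andP; split.
  by apply: ereal_inf_lbound; exists x.
by apply: le_ereal_inf_tmp => _ [y yS <-]; rewrite lee_fin xmin.
Qed.

End TwistMaps.

(* Main.v *)
(** The twist condition makes H submodular: exchanging the endpoints of two
    crossing steps strictly lowers the action.  Sorting a (2p,2q)-periodic
    sequence and its translate by (q,p) therefore shows that its action over 2q
    steps is at least 2 T_(p,q).  Take minimizers x of type (p,q-1) and y of type
    (p,q+1).  As x advances faster than y, the two sequences cross; exchanging
    the crossing steps joins them into a single (2p,2q)-periodic sequence.  If
    the crossing is strict, the action strictly decreases.  If it happens at a
    common point x_n = y_n, the action is unchanged but the new sequence is not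
    stationary at that point, because y is and x_(n+1) > y_(n+1); so a small
    displacement lowers the action.  Stationarity requires that minimizers exist
    in the interior of the constraints, which a first-order analysis of limits
    of minimizing sequences provides. *)

Require Import Defs.
From HB Require Import structures.
From mathcomp Require Import all_boot all_order all_algebra.
From mathcomp Require Import all_classical all_reals all_analysis.
From mathcomp Require Import zify ring lra.
Import Order.TTheory GRing.Theory Num.Theory.
Import numFieldNormedType.Exports.
Local Open Scope classical_set_scope.
Local Open Scope ring_scope.

Set Implicit Arguments.
Unset Strict Implicit.
Unset Printing Implicit Defensive.

(** * Box neighbourhoods, the domain of admissible steps, a mean value theorem *)

Definition around2 {R : realType} (x0 x0' : R) (P : R -> R -> Prop) : Prop :=
  exists2 e, 0 < e &
    forall x x', `|x - x0| < e -> `|x' - x0'| < e -> P x x'.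

Lemma around2W {R : realType} (x0 x0' : R) (P Q : R -> R -> Prop) :
  (forall x x', P x x' -> Q x x') -> around2 x0 x0' P -> around2 x0 x0' Q.
Proof. by move=> PQ [e e0 Pe]; exists e => // x x' xe x'e; apply: PQ; apply: Pe. Qed.

Lemma around2I {R : realType} (x0 x0' : R) (P Q : R -> R -> Prop) :
  around2 x0 x0' P -> around2 x0 x0' Q ->
  around2 x0 x0' (fun x x' => P x x' /\ Q x x').
Proof.
move=> [e e0 Pe] [d d0 Qd]; exists (Num.min e d); first by rewrite lt_min e0 d0.
by move=> x x'; rewrite !lt_min => /andP[? ?] /andP[? ?]; split; [apply: Pe|apply: Qd].
Qed.

Lemma around2_nbhs {R : realType} (x0 x0' : R) (P : R * R -> Prop) :
  (\forall z \near (x0, x0'), P z) -> around2 x0 x0' (fun x x' => P (x, x')).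
Proof.
move=> /nbhs_ballP[e /= e0 eP]; exists e => // x x' xe x'e; apply: eP.
by split; rewrite /ball /= distrC.
Qed.

Lemma gen_domain_convex {R : realType} (wm wp : \bar R) (x1 x1' x2 x2' x x' : R) :
  gen_domain wm wp x1 x1' -> gen_domain wm wp x2 x2' ->
  x1' - x1 <= x' - x <= x2' - x2 -> gen_domain wm wp x x'.
Proof.
rewrite /gen_domain => /andP[h1 _] /andP[_ h2] /andP[h3 h4]; apply/andP; split.
  by apply: (lt_le_trans h1); rewrite lee_fin.
by apply: (le_lt_trans _ h2); rewrite lee_fin.
Qed.

Lemma gen_domain_open {R : realType} (wm wp : \bar R) (x0 x0' : R) :
  gen_domain wm wp x0 x0' -> around2 x0 x0' (gen_domain wm wp).
Proof.
rewrite /gen_domain => /andP[h1 h2].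
have [e1 e10 He1] : exists2 e, 0 < e &
    forall x x', `|x - x0| < e -> `|x' - x0'| < e -> (wm < (x' - x)%:E)%E.
  case: wm h1 => [r||] //=; last by exists 1 => // *; rewrite ltNyr.
  rewrite lte_fin => h1; exists ((x0' - x0 - r) / 2); first by rewrite divr_gt0 ?subr_gt0.
  by move=> x x'; rewrite !ltr_norml lte_fin; lra.
have [e2 e20 He2] : exists2 e, 0 < e &
    forall x x', `|x - x0| < e -> `|x' - x0'| < e -> ((x' - x)%:E < wp)%E.
  case: wp h2 => [r||] //=; last by exists 1 => // *; rewrite ltry.
  rewrite lte_fin => h2; exists ((r - (x0' - x0)) / 2); first by rewrite divr_gt0 ?subr_gt0.
  by move=> x x'; rewrite !ltr_norml lte_fin; lra.
have := @around2I _ x0 x0' _ _ (ex_intro2 _ _ e1 e10 He1) (ex_intro2 _ _ e2 e20 He2).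
by apply: around2W => x x' [-> ->].
Qed.

(** The order of the endpoints is left free because points will be displaced to either side. *)
Lemma mvt_between {R : realType} (f df : R -> R) (a b : R) :
  (forall x, Num.min a b <= x <= Num.max a b -> is_derive x 1 f (df x)) ->
  exists2 c, Num.min a b <= c <= Num.max a b & f b - f a = df c * (b - a).
Proof.
move=> fd.
have mvt (u v : R) : u <= v -> (forall x, u <= x <= v -> is_derive x 1 f (df x)) ->
    exists2 c, u <= c <= v & f v - f u = df c * (v - u).
  move=> uv fuv; have [||c cuv e] := @MVT_segment R f df u v uv.
  - by move=> x; rewrite in_itv /= => /andP[? ?]; apply: fuv; rewrite !ltW.
  - apply: derivable_within_continuous => x; rewrite in_itv /= => xuv.
    by have [] := fuv x xuv.
  - by exists c => //; rewrite in_itv /= in cuv.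
case: (leP a b) fd => [ab|/ltW ba] fd.
  by rewrite ?(min_idPl ab) ?(max_idPr ab) in fd *; apply: mvt.
by have [c cab e] := mvt b a ba fd; exists c => //; lra.
Qed.

(* What remains of the twist map: [Y] and [Y'] are the ordinates y and y', that
   is - dH/dx and dH/dx', and the last two fields say that both tend to a
   (resp. b) at a finite end of the twist interval. *)
Record twist_action {R : realType} (wm wp : \bar R) (H Y Y' : R -> R -> R) : Prop := {
  action_derive1 : forall x x', gen_domain wm wp x x' ->
    is_derive x 1 (H^~ x') (- Y x x');
  action_derive2 : forall x x', gen_domain wm wp x x' ->
    is_derive x' 1 (H x) (Y' x x');
  action_continuous : forall x x', gen_domain wm wp x x' ->
    {for (x, x'), continuous (fun z : R * R => H z.1 z.2)};
  action_periodic : forall (k : int) x x', gen_domain wm wp x x' ->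
    H (x + k%:~R) (x' + k%:~R) = H x x';
  action_twist : forall x x1 x2, gen_domain wm wp x x1 ->
    gen_domain wm wp x x2 -> x1 < x2 -> Y x x1 < Y x x2;
  momentum_continuous1 : forall x x' e, gen_domain wm wp x x' -> 0 < e ->
    around2 x x' (fun u u' => gen_domain wm wp u u' -> `|Y u u' - Y x x'| < e);
  momentum_continuous2 : forall x x' e, gen_domain wm wp x x' -> 0 < e ->
    around2 x x' (fun u u' => gen_domain wm wp u u' -> `|Y' u u' - Y' x x'| < e);
  momentum_top : forall r, wp = r%:E -> exists b,
    (forall x x', (wm <= (x' - x)%:E)%E -> x' - x < r -> exists2 y, y < b &
       around2 x x' (fun u u' => gen_domain wm wp u u' -> Y u u' < y)) /\
    (forall x y, y < b ->
       around2 x (x + r) (fun u u' => gen_domain wm wp u u' -> y < Y' u u'));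
  momentum_bottom : forall r, wm = r%:E -> exists a,
    (forall x x', r < x' - x -> ((x' - x)%:E <= wp)%E -> exists2 y, a < y &
       around2 x x' (fun u u' => gen_domain wm wp u u' -> y < Y u u')) /\
    (forall x y, a < y ->
       around2 x (x + r) (fun u u' => gen_domain wm wp u u' -> Y' u u' < y)) }.

(** * The exchange inequality and local improvement of the action *)

Section TwistAction.
Context {R : realType} {wm wp : \bar R} {H Y Y' : R -> R -> R}.
Context (tw : twist_action wm wp H Y Y').
Local Notation D := (gen_domain wm wp).

(** By the twist, [H s x2' - H s x1'] has the negative derivative [Y s x1' - Y s x2'] in s, so it
    decreases from [x1] to [x2]. The two steps assumed admissible are the longest and the shortest,
    and convexity gives the whole rectangle. *)
Lemma action_exchange (x1 x2 x1' x2' : R) :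
  x1 < x2 -> x1' < x2' -> D x1 x2' -> D x2 x1' ->
  H x1 x1' + H x2 x2' < H x1 x2' + H x2 x1'.
Proof.
move=> x12 x12' D12 D21.
have Din s s' : x1 <= s <= x2 -> x1' <= s' <= x2' -> D s s'.
  by move=> s12 s12'; apply: (gen_domain_convex D21 D12); lra.
have [s|c] := @mvt_between R (fun s => H s x2' - H s x1')
    (fun s => - Y s x2' - (- Y s x1')) x1 x2.
  rewrite (min_idPl (ltW x12)) (max_idPr (ltW x12)) => s12.
  apply: is_deriveB; apply: (action_derive1 tw); apply: Din => //; lra.
rewrite (min_idPl (ltW x12)) (max_idPr (ltW x12)) => c12 e.
have := action_twist tw (Din c x1' c12 _) (Din c x2' c12 _) x12'.
move=> /(_ ltac:(lra) ltac:(lra)); nra.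
Qed.

(** [twist_action] records monotonicity for [Y] alone; for [Y'] it comes from the exchange
    inequality, which makes [H x1 s - H x2 s] increase with s near x'. Only the weak inequality
    survives differentiation. *)
Lemma momentum2_anti (x1 x2 x' : R) :
  x1 <= x2 -> D x1 x' -> D x2 x' -> Y' x2 x' <= Y' x1 x'.
Proof.
rewrite le_eqVlt => /orP[/eqP-> //|x12] D1 D2.
have [e e0 De1] := gen_domain_open D1; have [d d0 Dd2] := gen_domain_open D2.
pose r := Num.min e d; have r0 : 0 < r by rewrite lt_min e0 d0.
pose f s := H x1 s - H x2 s.
have fd s : s \in `]x' - r, x' + r[ -> is_derive s 1 f (Y' x1 s - Y' x2 s).
  rewrite in_itv /= => sr; have sr' : `|s - x'| < r by rewrite ltr_norml; lra.
  move: sr'; rewrite lt_min => /andP[se sd].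
  apply: is_deriveB; apply: (action_derive2 tw).
    by apply: De1 => //; rewrite subrr normr0.
  by apply: Dd2 => //; rewrite subrr normr0.
have x'r : x' \in `]x' - r, x' + r[ by rewrite in_itv /=; lra.
have : 0 <= derive1 f x'.
  apply: (@incr_derive1_ge0_itv R f false true (x' - r) (x' + r) x') => //.
    by move=> s; rewrite inE /= => sr; have [] := fd s sr.
  move=> s t; rewrite !in_itv /= => sr tr st; rewrite /f.
  have sr' : `|s - x'| < r by rewrite ltr_norml; lra.
  have tr' : `|t - x'| < r by rewrite ltr_norml; lra.
  move: sr' tr'; rewrite !lt_min => /andP[se sd] /andP[te td].
  have := @action_exchange x1 x2 s t x12 st.
  move=> /(_ (De1 _ _ _ te) (Dd2 _ _ _ sd)); rewrite !subrr normr0.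
  by move=> /(_ e0 d0); lra.
have := fd _ x'r => fdx; rewrite derive1E derive_val; lra.
Qed.

(** Since [H u s + H s v] has derivative [Y' u s - Y s v], moving the middle point in the direction
    [sg] gains at least [m2 - m1] per unit of length. The steps from u to c and from c to v need not
    be admissible, and the gain [d] is the same for all admissible steps near them, so that limits
    on the boundary of the domain are covered. *)
Lemma action_improve (sg u c v m1 m2 e0 : R) :
  sg = 1 \/ sg = -1 -> m1 < m2 -> 0 < e0 ->
  (forall e, 0 < e <= e0 ->
     [/\ u < c + sg * e, c + sg * e < v, D u (c + sg * e) & D (c + sg * e) v]) ->
  around2 u c (fun x x' => D x x' -> sg * Y' x x' < m1) ->
  around2 c v (fun x x' => D x x' -> m2 < sg * Y x x') ->
  exists e d n, [/\ 0 < d, 0 < n &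
    forall u' c' v', `|u' - u| < n -> `|c' - c| < n -> `|v' - v| < n ->
      D u' c' -> D c' v' ->
      [/\ u' <= c' + e <= v', D u' (c' + e), D (c' + e) v' &
          H u' (c' + e) + H (c' + e) v' <= H u' c' + H c' v' - d]].
Proof.
move=> sgE m12 e00 De [n1 n10 HY'] [n2 n20 HY].
(* Halves, because an intermediate point is within [e] of c', itself within [n] of c, and the two
   distances must add up to less than [n1] and [n2]. *)
pose e := Num.min e0 (Num.min (n1 / 2) (n2 / 2)).
have e_gt0 : 0 < e by rewrite !lt_min e00 !divr_gt0.
have [ele0 en1 en2] : [/\ e <= e0, e <= n1 / 2 & e <= n2 / 2].
  by split; rewrite /e !ge_min lexx ?orbT.
have [ue ev Due Dev] : [/\ u < c + sg * e, c + sg * e < v, D u (c + sg * e) &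
    D (c + sg * e) v] by apply: De; rewrite e_gt0.
have [n3 n30 H3] := gen_domain_open Due; have [n4 n40 H4] := gen_domain_open Dev.
(* The last two bounds keep the displaced point between u' and v'. *)
pose n := Num.min (Num.min n3 n4)
  (Num.min (Num.min (n1 / 2) (n2 / 2)) (Num.min ((c + sg * e - u) / 2) ((v - (c + sg * e)) / 2))).
have n0 : 0 < n by rewrite !lt_min n30 n40 !divr_gt0 // subr_gt0.
exists (sg * e), ((m2 - m1) * e), n; split => //.
  by rewrite mulr_gt0 // subr_gt0.
move=> u' c' v'; rewrite !lt_min.
move=> /and3P[/andP[u3 u4] /andP[u1 u2] /andP[u5 u6]].
move=> /and3P[/andP[c3 c4] /andP[c1 c2] /andP[c5 c6]].
move=> /and3P[/andP[v3 v4] /andP[v1 v2] /andP[v5 v6]] Duc Dcv.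
have ccE : c' + sg * e - (c + sg * e) = c' - c by ring.
have Due' : D u' (c' + sg * e) by apply: H3; rewrite ?ccE.
have Dev' : D (c' + sg * e) v' by apply: H4; rewrite ?ccE.
have u'v' : u' <= c' + sg * e <= v'.
  move: u5 c5 c6 v6; clear - tw; rewrite !ltr_norml; lra.
have u'n1 : `|u' - u| < n1 by apply: lt_trans u1 _; clear - tw n10; lra.
have v'n2 : `|v' - v| < n2 by apply: lt_trans v2 _; clear - tw n20; lra.
have sD s : Num.min c' (c' + sg * e) <= s <= Num.max c' (c' + sg * e) ->
    [/\ D u' s, D s v', `|s - c| < n1 & `|s - c| < n2].
  move=> sc; suff [Dus Dsv sce] : [/\ D u' s, D s v' & `|s - c'| <= e].
    split=> //; rewrite -(subrKA c') (le_lt_trans (ler_normD _ _)) //.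
      by move: sce c1 en1; clear - tw; lra.
    by move: sce c2 en2; clear - tw; lra.
  clear - tw sgE Due' Dev' Duc Dcv e_gt0 sc.
  case: sgE Due' Dev' sc => ->; rewrite ?mul1r ?mulN1r => Due' Dev'.
    rewrite minEle maxEle lerDl (ltW e_gt0) => sc; split.
    - by apply: (gen_domain_convex Duc Due'); rewrite !lerB //; case/andP: sc.
    - by apply: (gen_domain_convex Dev' Dcv); rewrite !lerB //; case/andP: sc.
    - by rewrite ger0_norm; lra.
  rewrite minElt maxElt ltrDl oppr_gt0 (lt_gtF e_gt0) => sc; split.
  - by apply: (gen_domain_convex Due' Duc); rewrite !lerB //; case/andP: sc.
  - by apply: (gen_domain_convex Dcv Dev'); rewrite !lerB //; case/andP: sc.
  - by rewrite ler0_norm; lra.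
have [s /sD[Dus Dsv _ _]|s] := @mvt_between R (fun s => H u' s + H s v')
    (fun s => Y' u' s - Y s v') c' (c' + sg * e).
  by apply: is_deriveD; [apply: (action_derive2 tw)|apply: (action_derive1 tw)].
move=> /sD[Dus Dsv s1 s2] E; split=> //.
have := HY' _ _ u'n1 s1 Dus; have := HY _ _ s2 v'n2 Dsv => m2Y Y'm1.
have : (m2 - m1) * e < (sg * Y s v' - sg * Y' u' s) * e by rewrite ltr_pM2r // ltrB.
by move: E; clear - tw; lra.
Qed.

End TwistAction.

(** * A lower bound for the action of a step with bounded endpoints *)

Section ActionBounds.
Context {R : realType} {wm wp : \bar R} {H Y Y' : R -> R -> R}.
Context (tw : twist_action wm wp H Y Y').
Local Notation D := (gen_domain wm wp).

Lemma diagonal_bounded (f : R -> R -> R) (c K : R) :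
  0 <= K -> (forall s, D s (s + c)) ->
  (forall x x' e, D x x' -> 0 < e ->
     around2 x x' (fun u u' => D u u' -> `|f u u' - f x x'| < e)) ->
  exists B, forall s, - K <= s <= K -> `|f s (s + c)| <= B.
Proof.
move=> K0 Dc fc; pose g s := `|f s (s + c)|.
have gc : continuous g.
  move=> s; apply: cvg_norm; apply/cvgrPdist_lt => e e0.
  have [d d0 fd] := fc _ _ _ (Dc s) e0.
  apply: filterS (nbhsx_ballx s d d0) => t; rewrite /ball /= distrC => st.
  rewrite distrC; apply: fd (Dc t) => //.
  by have -> : t + c - (s + c) = t - s by ring.
have [|t _ tm] := @EVT_max R g (- K) K _ (continuous_subspaceT gc); first lra.
by exists (g t) => s sK; apply: tm; rewrite in_itv.
Qed.

(** One endpoint is moved until the step has length c, where compactness bounds [H], [Y] and [Y']. A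
    longer step is shortened by raising x, with [Y s x'] at least [Y s (s + c)]; a shorter one is
    lengthened by raising x', with [Y' x s] at most [Y' (s - c) s]. The derivative is thus bounded
    on the side that matters, even near the boundary of the domain. *)
Lemma action_bounded_below (c C : R) : D 0 c -> 0 <= C ->
  exists m, forall x x', `|x| <= C -> `|x'| <= C -> D x x' -> m <= H x x'.
Proof.
move=> D0 C0; have Dc s : D s (s + c).
  by apply: (gen_domain_convex D0 D0); lra.
pose K := C + `|c|; have K0 : 0 <= K by rewrite addr_ge0 //.
have [|B1 hB1] := @diagonal_bounded H c K K0 Dc.
  move=> x x' e Dx e0; have := action_continuous tw Dx.
  move/cvgrPdist_lt => /(_ e e0) /around2_nbhs; apply: around2W => u u' /=.
  by rewrite distrC.
have [B2 hB2] := diagonal_bounded K0 Dc (@momentum_continuous1 _ _ _ _ _ _ tw).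
have [B3 hB3] := diagonal_bounded K0 Dc (@momentum_continuous2 _ _ _ _ _ _ tw).
have cK : - K + C <= c <= K - C by rewrite /K; move: (ler_norm c) (ler_norm (- c)); rewrite normrN; lra.
have B20 : 0 <= B2 by apply: le_trans (hB2 0 _) => //; lra.
have B30 : 0 <= B3 by apply: le_trans (hB3 0 _) => //; lra.
exists (- B1 - (B2 + B3) * (2 * K)) => x x'; rewrite !ler_norml => xC x'C Dx.
have [cx|xc] := leP c (x' - x).
- have xx' : x <= x' - c by lra.
  have [s|s] := @mvt_between R (H^~ x') (fun s => - Y s x') x (x' - c).
    rewrite (min_idPl xx') (max_idPr xx') => sx.
    by apply: (action_derive1 tw); apply: (gen_domain_convex D0 Dx); lra.
  rewrite (min_idPl xx') (max_idPr xx') => sx E.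
  have : - B1 <= H (x' - c) x'.
    by have := hB1 (x' - c); rewrite ler_norml subrK; lra.
  have : - B2 <= Y s x'.
    have := hB2 s; rewrite ler_norml => /(_ ltac:(lra)) /andP[Bs _].
    apply: le_trans Bs _; have : s + c <= x' by lra.
    rewrite le_eqVlt => /orP[/eqP-> //|scx]; apply/ltW/(action_twist tw) => //.
    by apply: (gen_domain_convex D0 Dx); lra.
  have : 0 <= B3 * (2 * K) by rewrite mulr_ge0 // mulr_ge0.
  by move: E; clear - tw B20 sx xC x'C cK cx; nra.
- have xx' : x' <= x + c by lra.
  have [s|s] := @mvt_between R (H x) (fun s => Y' x s) x' (x + c).
    rewrite (min_idPl xx') (max_idPr xx') => sx.
    by apply: (action_derive2 tw); apply: (gen_domain_convex Dx D0); lra.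
  rewrite (min_idPl xx') (max_idPr xx') => sx E.
  have : - B1 <= H x (x + c).
    by have := hB1 x; rewrite ler_norml; lra.
  have : Y' x s <= B3.
    have := hB3 (s - c); rewrite ler_norml subrK => /(_ ltac:(lra)) /andP[_ Bs].
    apply: le_trans Bs; apply: (momentum2_anti tw); first by lra.
      by apply: (gen_domain_convex D0 D0); lra.
    by apply: (gen_domain_convex Dx D0); lra.
  have : 0 <= B2 * (2 * K) by rewrite mulr_ge0 // mulr_ge0.
  by move: E; clear - tw B30 sx xC x'C cK xc; nra.
Qed.

End ActionBounds.

(** * Periodic sequences and their finite periods *)

Lemma int_const {T : Type} (f : int -> T) :
  (forall n, f (n + 1) = f n) -> forall n, f n = f 0.
Proof.
move=> f1; have fk n (k : nat) : f (n + k%:Z) = f n.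
  by elim: k => [|k IH]; rewrite ?addr0 // -addn1 PoszD addrA f1.
by case=> k; [rewrite -(fk 0 k) add0r|rewrite -(fk _ k.+1) NegzE addNr].
Qed.

Lemma exists_switch (P : nat -> Prop) (K : nat) :
  P 0%N -> ~ P K -> exists k, P k /\ ~ P k.+1.
Proof.
move=> P0 PK; apply: contrapT => /forallNP nP; apply: PK.
elim: K => // k Pk; apply: contrapT => nPk; exact: (nP k).
Qed.

Section Sequences.
Context {R : realType} {wm wp : \bar R}.
Local Notation D := (gen_domain wm wp).
Implicit Types (p : int) (q : nat) (x : int -> R).

Lemma pq_period p q x (n k : int) : pq_sequences wm wp p q x ->
  x (n + k * q%:Z) = x n + (k * p)%:~R.
Proof.
case=> _ xq _; have := @int_const _ (fun k => x (n + k * q%:Z) - (k * p)%:~R).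
move=> /(_ _ k) /=; rewrite !mul0r addr0 subr0 => <-; first by rewrite subrK.
by move=> {}k; rewrite !mulrDl !mul1r addrA xq rmorphD /=; ring.
Qed.

Lemma pq_mono p q x (m n : int) : pq_sequences wm wp p q x -> m <= n -> x m <= x n.
Proof.
case=> x1 _ _ mn; have -> : n = m + `|n - m|%N%:Z by lia.
elim: `|n - m|%N => [|k IH]; first by rewrite addr0.
by apply: (le_trans IH); rewrite -addn1 PoszD addrA.
Qed.

Lemma pq_shift p q x (m : int) : pq_sequences wm wp p q x ->
  pq_sequences wm wp p q (fun n => x (n + m)).
Proof. by case=> x1 xq xD; split=> n; rewrite addrAC. Qed.

Lemma pq_shift_action (H : R -> R -> R) p q x (m : int) :
  (forall (k : int) u v, D u v -> H (u + k%:~R) (v + k%:~R) = H u v) ->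
  pq_sequences wm wp p q x -> action H q (fun n => x (n + m)) = action H q x.
Proof.
move=> Hper [x1 xq xD].
have := @int_const _ (fun m => action H q (fun n => x (n + m))).
move=> /(_ _ m) ->; first by apply: eq_bigr => i _; rewrite !addr0.
move=> {}m; pose h (i : nat) := H (x (i%:Z + m)) (x (i%:Z + m + 1)).
have actE : action H q (fun n => x (n + m)) = \sum_(i < q) h i.
  by apply: eq_bigr => i _; rewrite /h addrAC.
have act1E : action H q (fun n => x (n + (m + 1))) = \sum_(i < q) h i.+1.
  by apply: eq_bigr => i _; rewrite /h -addn1 PoszD; congr (H (x _) (x _)); ring.
(* The same sum is split at its first term and at its last one; these two terms agree by
   periodicity. *)
have : \sum_(i < q.+1) h i = \sum_(i < q.+1) h i by [].
rewrite {1}big_ord_recl big_ord_recr /= -act1E -actE.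
have -> : h q = h 0%N; last first.
  by move=> /eqP; rewrite [X in X == _]addrC (inj_eq (addIr _)) => /eqP.
rewrite /h add0r [q%:Z + m]addrC addrAC !xq Hper //.
Qed.

Lemma pq_translate (H : R -> R -> R) p q x (k : int) :
  (forall (k : int) u v, D u v -> H (u + k%:~R) (v + k%:~R) = H u v) ->
  pq_sequences wm wp p q x ->
  pq_sequences wm wp p q (fun n => x n + k%:~R) /\
  action H q (fun n => x n + k%:~R) = action H q x.
Proof.
move=> Hper [x1 xq xD]; split; last by apply: eq_bigr => i _; rewrite Hper.
split=> n; first by rewrite lerD2r.
  by rewrite xq addrAC.
by apply: (gen_domain_convex (xD n) (xD n)); lra.
Qed.

(** One period with both endpoints: a finite object that can be cut, joined and altered at one
    index. *)
Definition period_path p q (f : nat -> R) : Prop :=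
  f q = f 0%N + p%:~R /\
  forall i, (i < q)%N -> f i <= f i.+1 /\ D (f i) (f i.+1).

Definition path_action (H : R -> R -> R) q (f : nat -> R) : R :=
  \sum_(i < q) H (f i) (f i.+1).

Lemma pq_period_path p q x : pq_sequences wm wp p q x ->
  period_path p q (fun i => x i%:Z) /\
  forall H, path_action H q (fun i => x i%:Z) = action H q x.
Proof.
case=> x1 xq xD; split; last by move=> H; apply: eq_bigr => i _; rewrite -addn1 PoszD.
by split=> [|i _]; [rewrite -xq add0r|rewrite -addn1 PoszD].
Qed.

Lemma period_path_pq p q f : (0 < q)%N -> period_path p q f ->
  exists x, [/\ pq_sequences wm wp p q x,
    forall i, (i <= q)%N -> x i%:Z = f i &
    forall H, action H q x = path_action H q f].
Proof.
move=> q0 [fq f1]; have q0' : q%:Z != 0 by rewrite -lt0n.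
pose x (n : int) := f `|(n %% q)%Z|%N + ((n %/ q)%Z * p)%:~R.
(* Allowing [r = q] lets the last step of a period be treated like the others. *)
have xE (d : int) r : (r <= q)%N -> x (r%:Z + d * q%:Z) = f r + (d * p)%:~R.
  rewrite leq_eqVlt => /orP[/eqP->|rq]; rewrite /x.
    have -> : q%:Z + d * q%:Z = (d + 1) * q%:Z by ring.
    by rewrite modzMl mulzK //= fq mulrDl mul1r rmorphD /=; ring.
  by rewrite [r%:Z + _]addrC modzMDl divzMDl // modz_small ?divz_small ?addr0.
have nE (n : int) : exists d r, (r < q)%N /\ n = r%:Z + d * q%:Z.
  exists (n %/ q)%Z, `|(n %% q)%Z|%N; rewrite {2}(divz_eq n q) addrC.
  have := modz_ge0 n q0'; have := @ltz_pmod n q%:Z; lia.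
have xf i : (i <= q)%N -> x i%:Z = f i.
  by move=> iq; have := xE 0 i iq; rewrite !mul0r !addr0.
exists x; split=> //.
- split=> n; have [d [r [rq ->]]] := nE n.
  + rewrite addrAC -PoszD addn1 !xE ?(ltnW rq) // lerD2r; exact: (f1 r rq).1.
  + have -> : r%:Z + d * q%:Z + q%:Z = r%:Z + (d + 1) * q%:Z by ring.
    by rewrite !xE ?(ltnW rq) // mulrDl mul1r rmorphD addrA.
  + rewrite addrAC -PoszD addn1 !xE ?(ltnW rq) //.
    by have D1 := (f1 r rq).2; apply: (gen_domain_convex D1 D1); lra.
- move=> H; apply: eq_bigr => i _.
  by rewrite -PoszD addn1 !xf ?(ltnW (ltn_ord i)) ?ltn_ord.
Qed.

(** The moved index [k.+1] lies strictly between 0 and [q], so the closing condition is untouched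
    and only two terms of the action change. *)
Lemma period_path_bump (H : R -> R -> R) p q f k e :
  (k.+1 < q)%N -> period_path p q f ->
  f k <= f k.+1 + e <= f k.+2 -> D (f k) (f k.+1 + e) -> D (f k.+1 + e) (f k.+2) ->
  exists2 g, period_path p q g & path_action H q g - path_action H q f =
    H (f k) (f k.+1 + e) + H (f k.+1 + e) (f k.+2)
    - (H (f k) (f k.+1) + H (f k.+1) (f k.+2)).
Proof.
move=> kq [fq f1] /andP[fke kef] D1 D2.
pose g i := if i == k.+1 then f i + e else f i.
have gE i : i != k.+1 -> g i = f i by rewrite /g => /negbTE->.
have gk : g k.+1 = f k.+1 + e by rewrite /g eqxx.
have gkE : g k = f k by rewrite gE //; lia.
have gk2E : g k.+2 = f k.+2 by rewrite gE //; lia.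
exists g.
  split; first by (rewrite !gE //; lia).
  move=> i iq; have [->|ik] := eqVneq i k; first by rewrite gk gkE.
  have [->|ik1] := eqVneq i k.+1; first by rewrite gk gk2E.
  by (rewrite !gE //; [apply: f1|lia..]).
rewrite /path_action -!(big_mkord xpredT (fun i => H (_ i) (_ i.+1))).
have kq0 := ltn_trans (ltnSn k) kq.
rewrite !(@big_cat_nat _ _ _ k 0 q) ?(ltnW kq0) //=.
rewrite !(@big_ltn _ _ _ k q) // !(@big_ltn _ _ _ k.+1 q) // gk gkE gk2E.
have -> : \sum_(0 <= i < k) H (g i) (g i.+1) = \sum_(0 <= i < k) H (f i) (f i.+1).
  by apply: eq_big_nat => i ik; rewrite !gE //; lia.
have -> : \sum_(k.+2 <= i < q) H (g i) (g i.+1) = \sum_(k.+2 <= i < q) H (f i) (f i.+1).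
  by apply: eq_big_nat => i ik; rewrite !gE //; lia.
by lra.
Qed.

End Sequences.

Arguments period_path {R} wm wp p q f.

(** * Sorting, splitting and joining periodic paths *)

Section CutAndPaste.
Context {R : realType} {wm wp : \bar R} {H Y Y' : R -> R -> R}.
Context (tw : twist_action wm wp H Y Y').
Local Notation D := (gen_domain wm wp).

(** Sorting recombines the two steps only if they cross, and then the exchange inequality applies;
    crossing at a common endpoint leaves the sum unchanged. *)
Lemma action_min_max (x x' z z' : R) : D x x' -> D z z' ->
  [/\ D (Num.min x z) (Num.min x' z'), D (Num.max x z) (Num.max x' z') &
      H (Num.min x z) (Num.min x' z') + H (Num.max x z) (Num.max x' z') <=
      H x x' + H z z'].
Proof.
move=> Dx Dz; rewrite !minEle !maxEle.
have [xz|zx] := leP x z; have [x'z'|z'x'] := leP x' z'.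
- by split.
- have [D1 D2] : D x z' /\ D z x'.
    by split; [apply: (gen_domain_convex Dz Dx)|apply: (gen_domain_convex Dz Dx)]; lra.
  split=> //; move: xz; rewrite le_eqVlt => /orP[/eqP->|xz]; first by rewrite addrC.
  by have := action_exchange tw xz z'x' Dx Dz; lra.
- have [D1 D2] : D z x' /\ D x z'.
    by split; [apply: (gen_domain_convex Dx Dz)|apply: (gen_domain_convex Dx Dz)]; lra.
  split=> //; move: x'z'; rewrite le_eqVlt => /orP[/eqP->|x'z']; first by rewrite addrC.
  by have := action_exchange tw zx x'z' Dz Dx; lra.
- by split=> //; rewrite addrC.
Qed.

(* Sorting w and its translate by (q,p) pointwise yields two (p,q)-periodic
   sequences. *)
Lemma double_path_split p q (w : nat -> R) :
  period_path wm wp (p + p) (q + q) w ->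
  exists z z', [/\ period_path wm wp p q z,
    period_path wm wp p q z' &
    path_action H q z + path_action H q z' <= path_action H (q + q) w].
Proof.
move=> [wq w1]; pose v i := w (i + q)%N - p%:~R.
have Dw i : (i < q)%N -> D (w i) (w i.+1) by move=> iq; apply: (w1 i _).2; lia.
have Dv i : (i < q)%N -> D (v i) (v i.+1).
  move=> iq; have D1 := (w1 (i + q)%N ltac:(lia)).2.
  by apply: (gen_domain_convex D1 D1); rewrite /v addSn; lra.
have v1 i : (i < q)%N -> v i <= v i.+1.
  by move=> iq; rewrite lerD2r addSn; apply: (w1 (i + q)%N ltac:(lia)).1.
have w1' i : (i < q)%N -> w i <= w i.+1 by move=> iq; apply: (w1 i ltac:(lia)).1.
(* After [q] steps [w] and [v] have exchanged places up to [p], which is why their minimum and their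
   maximum each close up. *)
have vq : v q = w 0%N + p%:~R by rewrite /v wq rmorphD /=; ring.
have wv0 : w q = v 0%N + p%:~R by rewrite /v add0n subrK.
exists (fun i => Num.min (w i) (v i)), (fun i => Num.max (w i) (v i)); split.
- split=> [|i iq]; first by rewrite vq wv0 minC addr_minl.
  have [? _ _] := action_min_max (Dw i iq) (Dv i iq); split=> //.
  by rewrite le_min !ge_min w1' ?v1 ?orbT.
- split=> [|i iq]; first by rewrite vq wv0 maxC addr_maxl.
  have [_ ? _] := action_min_max (Dw i iq) (Dv i iq); split=> //.
  by rewrite ge_max !le_max w1' ?v1 ?orbT.
rewrite -big_split /= /path_action big_split_ord /= -big_split /=.
apply: ler_sum => i _; have [_ _] := action_min_max (Dw i (ltn_ord i)) (Dv i (ltn_ord i)).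
have -> : H (v i) (v i.+1) = H (w (q + i)%N) (w (q + i).+1).
  rewrite -(@action_periodic _ _ _ _ _ _ tw p); last exact: Dv.
  by rewrite /v !subrK addSn addnC.
by [].
Qed.

(* At a crossing [f 0 <= g 0], [g 1 < f 1], the two closed walks f and g are
   joined into one by exchanging their first steps. *)
Lemma period_path_merge p n1 n2 (f g : nat -> R) :
  period_path wm wp p n1.+1 f ->
  period_path wm wp p n2.+1 g ->
  f 0%N <= g 0%N -> g 1%N < f 1%N ->
  exists w, [/\ period_path wm wp (p + p) (n1.+1 + n2.+1) w,
    forall i, (i <= n2)%N -> w i = g i.+1, w n2.+1 = f 1%N + p%:~R &
    path_action H (n1.+1 + n2.+1) w =
      path_action H n1.+1 f + path_action H n2.+1 g
      - (H (f 0%N) (f 1%N) + H (g 0%N) (g 1%N))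
      + (H (f 0%N) (g 1%N) + H (g 0%N) (f 1%N))].
Proof.
move=> [fq f1] [gq g1] fg0 gf1.
have [f01 Df] := f1 0%N isT; have [g01 Dg] := g1 0%N isT.
have D1 : D (g 0%N) (f 1%N) by apply: (gen_domain_convex Dg Df); lra.
have D2 : D (f 0%N) (g 1%N) by apply: (gen_domain_convex Dg Df); lra.
pose P : R := p%:~R.
have DP u v : D u v -> D (u + P) (v + P).
  by move=> Duv; apply: (gen_domain_convex Duv Duv); lra.
have HP u v : D u v -> H (u + P) (v + P) = H u v.
  by move=> Duv; rewrite (action_periodic tw).
(* The path runs through g from index 1 to its end [g 0 + p], jumps to [f 1 + p], follows f to
   [f 0 + 2p], and jumps to [g 1 + 2p]. The two jumps are the exchanged steps. *)
pose w i := if (i <= n2)%N then g i.+1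
  else if (i <= n1 + n2.+1)%N then f (i - n2)%N + P else g 1%N + P + P.
have wg i : (i <= n2)%N -> w i = g i.+1 by rewrite /w => ->.
have wf i : (i <= n1)%N -> w (n2.+1 + i)%N = f i.+1 + P.
  by move=> i1; rewrite /w ifF ?ifT; [congr (f _ + _)| |]; lia.
have wl : w (n1.+1 + n2.+1)%N = g 1%N + P + P by rewrite /w !ifF //; lia.
have wn : w n2.+1 = f 1%N + P by have := wf 0%N isT; rewrite addn0.
have gn : g n2.+1 = g 0%N + P by [].
have fn : f n1.+1 = f 0%N + P by [].
exists w; split=> //.
  split=> [|i iN]; first by rewrite wl wg // rmorphD /= addrA.
  have [in2|] := ltnP i n2; first by rewrite !wg ?(ltnW in2) //; apply: g1.
  rewrite leq_eqVlt => /orP[/eqP<-|n2i].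
    rewrite wg // wn gn; split; last exact: DP.
    by rewrite lerD2r; lra.
  have [j iE] : exists j, i = (n2.+1 + j)%N by exists (i - n2.+1)%N; lia.
  rewrite iE.
  have [jn1|] := ltnP j n1.
    rewrite -addnS !wf //; last exact: ltnW.
    have [? ?] := f1 j.+1 jn1; split; last exact: DP.
    by rewrite lerD2r.
  move=> n1j; have -> : j = n1 by lia.
  have -> : (n2.+1 + n1).+1 = (n1.+1 + n2.+1)%N by lia.
  rewrite wf // wl fn; split; last exact: (DP _ _ (DP _ _ D2)).
  by rewrite !lerD2r; lra.
have recl n h : path_action H n.+1 h =
    H (h 0%N) (h 1%N) + \sum_(i < n) H (h i.+1) (h i.+2).
  by rewrite /path_action big_ord_recl.
rewrite (recl n1 f) (recl n2 g) /path_action addnC big_split_ord /= !big_ord_recr /=.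
have -> : \sum_(i < n2) H (w i) (w i.+1) = \sum_(i < n2) H (g i.+1) (g i.+2).
  by apply: eq_bigr => i _; rewrite !wg // ltnW.
have -> : \sum_(i < n1) H (w (n2.+1 + i)%N) (w (n2.+1 + i).+1) =
    \sum_(i < n1) H (f i.+1) (f i.+2).
  apply: eq_bigr => i _; have i1 := ltn_ord i.
  by rewrite -addnS (wf i (ltnW i1)) (wf i.+1 i1) (HP _ _ (f1 i.+1 i1).2).
have -> : (n2.+1 + n1).+1 = (n1.+1 + n2.+1)%N by lia.
rewrite wg // wn wf // wl gn fn (HP _ _ D1) (HP _ _ (DP _ _ D2)) (HP _ _ D2).
move: (\sum_(i < n2) _) (\sum_(i < n1) _) (H (f 0%N) (f 1%N)) (H (g 0%N) (g 1%N)).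
move: (H (f 0%N) (g 1%N)) (H (g 0%N) (f 1%N)) => a1 a2 s2 s1 a3 a4.
ring.
Qed.

End CutAndPaste.

(** * First-order conditions and strict monotonicity of minimizers *)

Section Minimizers.
Context {R : realType} {wm wp : \bar R} {H Y Y' : R -> R -> R}.
Context (tw : twist_action wm wp H Y Y').
Local Notation D := (gen_domain wm wp).

(** At an admissible triple, continuity of the momenta extends the sign of the slope to a
    neighbourhood. Room is required only on the side of the move, since u or v may coincide with
    c. *)
Lemma action_improve_interior (sg u c v : R) :
  sg = 1 /\ c < v \/ sg = -1 /\ u < c -> u <= c <= v -> D u c -> D c v ->
  sg * (Y' u c - Y c v) < 0 ->
  exists e, [/\ u <= c + e <= v, D u (c + e), D (c + e) v &
    H u (c + e) + H (c + e) v < H u c + H c v].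
Proof.
move=> sguv /andP[uc cv] Duc Dcv gneg.
have sgE : sg = 1 \/ sg = -1 by case: sguv => -[]; [left|right].
have sgN z : `|sg * z| = `|z|.
  by rewrite normrM; case: sgE => ->; rewrite ?normrN normr1 mul1r.
(* A third of the gap, so that the two bounds [sg * Y' u c + k] and [sg * Y c v - k] remain
   separated. *)
pose k := (sg * Y c v - sg * Y' u c) / 3.
have k0 : 0 < k by rewrite divr_gt0 // subr_gt0 -subr_lt0 -mulrBr.
have [n1 n10 H1] := gen_domain_open Duc; have [n2 n20 H2] := gen_domain_open Dcv.
have [l l0 lP] : exists2 l, 0 < l &
    forall e, 0 < e -> e <= l / 2 -> u < c + sg * e < v.
  case: sguv => -[-> ?]; [exists (v - c)|exists (c - u)]; rewrite ?subr_gt0 // => e; lra.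
pose e0 := Num.min (l / 2) (Num.min (n1 / 2) (n2 / 2)).
have e00 : 0 < e0 by rewrite !lt_min !divr_gt0.
have [||||e [d [n [d0 n0 imp]]]] := @action_improve _ _ _ _ _ _ tw sg u c v
    (sg * Y' u c + k) (sg * Y c v - k) e0 sgE _ e00.
- by move: k0; rewrite /k; lra.
- move=> e /andP[e_gt0]; rewrite !le_min => /and3P[el en1 en2].
  have cce : `|c + sg * e - c| = e.
    by rewrite addrAC subrr add0r sgN gtr0_norm.
  have /andP[uce cev] := lP e e_gt0 el; split=> //.
  + by apply: H1; rewrite ?subrr ?normr0 // cce; lra.
  + by apply: H2; rewrite ?subrr ?normr0 // cce; lra.
- apply: around2W (momentum_continuous2 tw Duc k0) => x x' h Dx.
  by move: (h Dx); rewrite -sgN ltr_norml; lra.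
- apply: around2W (momentum_continuous1 tw Dcv k0) => x x' h Dx.
  by move: (h Dx); rewrite -sgN ltr_norml; lra.
exists e; have [|||h1 h2 h3 h4] := imp u c v _ _ _ Duc Dcv; rewrite ?subrr ?normr0 //.
by split=> //; lra.
Qed.

Lemma pq_bump p q x n e : (1 < q)%N -> pq_sequences wm wp p q x ->
  x (n - 1) <= x n + e <= x (n + 1) ->
  D (x (n - 1)) (x n + e) -> D (x n + e) (x (n + 1)) ->
  exists2 z, pq_sequences wm wp p q z & action H q z - action H q x =
    H (x (n - 1)) (x n + e) + H (x n + e) (x (n + 1))
    - (H (x (n - 1)) (x n) + H (x n) (x (n + 1))).
Proof.
move=> q1 xS le_e D1 D2; have yS := pq_shift (n - 1) xS.
have [fS fA] := pq_period_path yS.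
have e0 : 0%:Z + (n - 1) = n - 1 by rewrite add0r.
have e1 : 1%:Z + (n - 1) = n by ring.
have e2 : 2%:Z + (n - 1) = n + 1 by ring.
have [| | |g gS gA] := @period_path_bump _ _ _ H p q _ 0 e q1 fS; rewrite ?e0 ?e1 ?e2 //.
have [z [zS _ zA]] := period_path_pq (ltnW q1) gS; exists z => //.
rewrite zA -(pq_shift_action (n - 1) (@action_periodic _ _ _ _ _ _ tw) xS) -fA gA.
by rewrite e0 e1 e2.
Qed.

Definition is_minimizer p q x : Prop := pq_sequences wm wp p q x /\
  forall z, pq_sequences wm wp p q z -> action H q x <= action H q z.

(** Stationarity is one-sided: where the monotonicity constraint is active, only moves away from it
    are available for comparison. *)
Lemma minimizer_first_order p q x n sg : (1 < q)%N -> is_minimizer p q x ->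
  sg = 1 /\ x n < x (n + 1) \/ sg = -1 /\ x (n - 1) < x n ->
  0 <= sg * (Y' (x (n - 1)) (x n) - Y (x n) (x (n + 1))).
Proof.
move=> q1 [xS xmin] sgx; rewrite leNgt; apply/negP => gneg.
have [x1 _ xD] := xS; have := x1 (n - 1); have := xD (n - 1); rewrite subrK => Dx x1'.
have [|e [le_e D1 D2 lt_e]] := action_improve_interior sgx _ Dx (xD n) gneg.
  by rewrite x1' x1.
have [z /xmin zx zA] := pq_bump q1 xS le_e D1 D2.
lra.
Qed.

(* If [x] takes a value c on a maximal run of at least two indices, neither
   raising its last occurrence nor lowering its first one can lower the action,
   so that Y c c < Y' c c <= Y c c. *)
Lemma minimizer_increasing p q x : 0 < p -> (0 < q)%N -> is_minimizer p q x ->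
  forall n, x n < x (n + 1).
Proof.
move=> p0 q0 xmin n; have [xS _] := xmin; have [x1 xq xD] := xS.
have p0' : 0 < p%:~R :> R by rewrite ltr0z.
rewrite lt_neqAle x1 andbT; apply/negP => /eqP xn.
have q1 : (1 < q)%N.
  rewrite ltn_neqAle q0 andbT; apply/negP => /eqP q1.
  by have := xq n; rewrite -q1 -xn; lra.
set c := x n in xn.
have [k [xk xk1]] := @exists_switch (fun k => x (n + 1 + k%:Z) = c) q
  ltac:(by rewrite /= addr0) ltac:(by rewrite /= xq -xn; lra).
have [l [xl xl1]] := @exists_switch (fun k => x (n - k%:Z) = c) q
  ltac:(by rewrite /= subr0) ltac:(by rewrite /=; have := xq (n - q%:Z); rewrite subrK -/c; lra).
have Dcc : D c c by have := xD n; rewrite -xn.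
(* The strictness comes from the twist, since the value following the run exceeds [c]. *)
have lt1 : Y c c < Y' c c.
  have h : c < x (n + 1 + k%:Z + 1).
    rewrite lt_neqAle -{2}xk x1 andbT eq_sym; apply/eqP.
    by move: xk1; rewrite -addn1 PoszD addrA.
  have E : x (n + 1 + k%:Z - 1) = c.
    apply/eqP; rewrite eq_le -{1}xk !(pq_mono xS) //; lia.
  have := @minimizer_first_order p q x (n + 1 + k%:Z) 1 q1 xmin.
  rewrite E xk mul1r subr_ge0 => /(_ (or_introl (conj erefl h))).
  apply: lt_le_trans; apply: (action_twist tw) => //.
  by have := xD (n + 1 + k%:Z); rewrite xk.
have le2 : Y' c c <= Y c c.
  have xl1' : x (n - l%:Z - 1) <> c.
    by move: xl1; rewrite -addn1 PoszD opprD addrA.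
  have h : x (n - l%:Z - 1) < c.
    rewrite lt_neqAle; apply/andP; split; first exact/eqP.
    by rewrite -xl (pq_mono xS) //; lia.
  have E : x (n - l%:Z + 1) = c.
    apply/eqP; rewrite eq_le; apply/andP; split; [rewrite xn|by rewrite -xl].
    by apply: (pq_mono xS); lia.
  have := @minimizer_first_order p q x (n - l%:Z) (-1) q1 xmin.
  rewrite E xl mulN1r oppr_ge0 subr_le0 => /(_ (or_intror (conj erefl h))).
  apply: le_trans; apply: (momentum2_anti tw (ltW h)) => //.
  by have := xD (n - l%:Z - 1); rewrite subrK xl.
by have := lt_le_trans lt1 le2; rewrite ltxx.
Qed.

End Minimizers.

Arguments is_minimizer {R} wm wp H p q x.

(** * Compactness of minimizing sequences *)

Section Existence.
Context {R : realType} {wm wp : \bar R} {H Y Y' : R -> R -> R}.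
Context (tw : twist_action wm wp H Y Y').
Local Notation D := (gen_domain wm wp).
Local Notation pqS := (pq_sequences wm wp).

Lemma pq_linear p q : 0 <= p -> (0 < q)%N ->
  (wm < (p%:~R / q%:R : R)%:E < wp)%E -> pqS p q (fun n => n%:~R * (p%:~R / q%:R)).
Proof.
move=> p0 q0 pq; have q0' : (q%:R : R) != 0 by rewrite pnatr_eq0 -lt0n.
have stepE n : (n + 1)%:~R * (p%:~R / q%:R) - n%:~R * (p%:~R / q%:R) = p%:~R / q%:R :> R.
  by rewrite rmorphD /=; ring.
split=> n.
- by rewrite -subr_ge0 stepE divr_ge0 // ler0z.
- by rewrite rmorphD /= mulrDl pmulrn [X in _ + X]mulrCA divff ?mulr1.
- by rewrite /gen_domain stepE.
Qed.

(** An integer translation brings [x 0] into [0, 1]; by monotonicity a whole period then stays in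
    [0, 1 + p], where each step has action at least [m]. *)
Lemma pq_action_bounded_below p q : 0 <= p -> (0 < q)%N ->
  (wm < (p%:~R / q%:R : R)%:E < wp)%E ->
  exists m, forall x, pqS p q x -> m <= action H q x.
Proof.
move=> p0 q0 pq.
have [||m hm] := @action_bounded_below _ _ _ _ _ _ tw (p%:~R / q%:R) (1 + p%:~R).
- by rewrite /gen_domain subr0.
- by rewrite addr_ge0 // ler0z.
exists (\sum_(i < q) m) => x xS.
have [yS <-] := pq_translate (- Num.floor (x 0)) (@action_periodic _ _ _ _ _ _ tw) xS.
have x0 : 0 <= x 0 - (Num.floor (x 0))%:~R <= 1.
  by have := floor_itv (x 0); rewrite intrD; lra.
apply: ler_sum => i _; have iq := ltn_ord i.
have yb (j : int) : 0 <= j -> j <= q%:Z ->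
    `|x j + (- Num.floor (x 0))%:~R| <= 1 + p%:~R.
  move=> j0 jq; have := pq_mono yS j0; have := pq_mono yS jq.
  have [_ xq _] := xS; rewrite -[q%:Z in X in X -> _]add0r xq.
  by rewrite mulrNz ler_norml; have := ler0z R p; rewrite p0; lra.
apply: hm; [apply: yb; lia..|].
by have [_ _ yD] := yS; apply: yD.
Qed.

(* Near-minimizers starting in [0,1] lie in a compact product of segments; their
   cluster point might a priori leave the domain of [H], where the steps reach
   wm or wp. *)
Lemma cluster_minimizing p q : 0 <= p -> (0 < q)%N ->
  (wm < (p%:~R / q%:R : R)%:E < wp)%E ->
  exists T (X : prod_topology (fun _ : int => R)),
    (forall x, pqS p q x -> T <= action H q x) /\
    forall U d, nbhs X U -> 0 < d -> exists x, [/\ pqS p q x, U x & action H q x < T + d].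
Proof.
move=> p0 q0 pq; have [m hm] := pq_action_bounded_below p0 q0 pq.
have linS := pq_linear p0 q0 pq.
pose A := [set action H q x | x in pqS p q].
have Ainf : has_inf A.
  split; first by exists (action H q (fun n => n%:~R * (p%:~R / q%:R))); exists (fun n => n%:~R * (p%:~R / q%:R)).
  by exists m => _ [x xS <-]; apply: hm.
pose T := inf A; have TA x : pqS p q x -> T <= action H q x.
  by move=> xS; apply: ge_inf; [exact: Ainf.2|exists x].
pose B d : set (prod_topology (fun _ : int => R)) :=
  [set x | [/\ pqS p q x, 0 <= x 0 <= 1 & action H q x < T + d]].
have B0 d : 0 < d -> B d !=set0.
  move=> d0; have [_ [x xS <-] xT] := inf_adherent d0 Ainf.
  have [yS yA] := pq_translate (- Num.floor (x 0)) (@action_periodic _ _ _ _ _ _ tw) xS.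
  exists (fun n => x n + (- Num.floor (x 0))%:~R); split=> //; last by rewrite yA.
  by have := floor_itv (x 0); rewrite intrD mulrNz; lra.
pose F := filter_from [set d : R | 0 < d] B.
have FF : ProperFilter F.
  apply: filter_from_proper => //; apply: filter_from_filter; first by exists 1 => /=.
  move=> d e d0 e0; exists (Num.min d e); first by rewrite /= lt_min d0 e0.
  by move=> x [xS x0]; rewrite -ltrBlDl lt_min !ltrBlDl => /andP[? ?].
(* As [q] is at least 1, [x n] lies between [x 0] and [x (n * q) = x 0 + n p], whence these
   segments. *)
pose K : set (prod_topology (fun _ : int => R)) :=
  [set f | forall n : int, `[- (`|n|%N%:R * p%:~R), 1 + `|n|%N%:R * p%:~R]%classic (f n)].
have Kc : compact K.
  apply: (@tychonoff int (fun=> R) (fun n => `[- (`|n|%N%:R * p%:~R), 1 + `|n|%N%:R * p%:~R]%classic)).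
  by move=> n; exact: segment_compact.
have FK : F K.
  exists 1 => //= x [xS x0 _] n /=; rewrite in_itv /=.
  have := @pq_period _ _ _ p q x 0 n xS; rewrite add0r => xn.
  have [n0|n0] := leP 0 n.
    have nE : n%:~R = `|n|%N%:R :> R by rewrite natr_absz ger0_norm.
    have := pq_mono xS n0; have : x n <= x (n * q%:Z) by apply: (pq_mono xS); nia.
    rewrite xn intrM nE; have : 0 <= `|n|%N%:R * p%:~R :> R by rewrite mulr_ge0 // ler0z.
    lra.
  have nE : - n%:~R = `|n|%N%:R :> R by rewrite natr_absz ltr0_norm // mulrNz.
  have := pq_mono xS (ltW n0); have : x (n * q%:Z) <= x n by apply: (pq_mono xS); nia.
  rewrite xn intrM -nE; have : 0 <= `|n|%N%:R * p%:~R :> R by rewrite mulr_ge0 // ler0z.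
  rewrite -nE; lra.
have [X [_ clX]] := Kc F FF FK.
exists T, X; split=> // U d XU d0.
have FB : F (B d) by exists d.
by have [x [[xS _ xd] Ux]] := clX _ _ FB XU; exists x.
Qed.

End Existence.

(** * Limits of minimizing sequences are interior, hence minimizers *)

Section Attained.
Context {R : realType} {wm wp : \bar R} {H Y Y' : R -> R -> R}.
Context (tw : twist_action wm wp H Y Y').
Local Notation D := (gen_domain wm wp).
Local Notation pqS := (pq_sequences wm wp).
Local Notation seqT := (prod_topology (fun _ : int => R)).

Lemma nbhs_coord (X : seqT) n e : 0 < e -> nbhs X [set f : seqT | `|f n - X n| < e].
Proof.
move=> e0.
have cX : (fun f : seqT => f n) @ X --> (X n : R).
  exact: (@proj_continuous int (fun=> R) n X).
move: cX => /cvgrPdist_lt/(_ e e0).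
by apply: filterS => f /=; rewrite distrC.
Qed.

Lemma action_seq_continuous q (X : seqT) : (forall n, D (X n) (X (n + 1))) ->
  action H q f @[f --> X] --> action H q X.
Proof.
move=> XD; have term i : H (f i%:Z) (f (i%:Z + 1)) @[f --> X] --> H (X i%:Z) (X (i%:Z + 1)).
  have cX (n : int) : (fun f : seqT => f n) @ X --> (X n : R).
    exact: (@proj_continuous int (fun=> R) n X).
  exact: (cvg_comp _ _ (cvg_pair (cX i%:Z) (cX (i%:Z + 1))) (action_continuous tw (XD i%:Z))).
have act0 f : action H 0 f = 0 by rewrite /action big_ord0.
have actS n f : action H n.+1 f = action H n f + H (f n%:Z) (f (n%:Z + 1)).
  by rewrite /action big_ord_recr.
elim: q => [|q IH].
  rewrite act0 (_ : (fun f : seqT => action H 0 f) = cst 0); last exact/funext.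
  exact: (@cst_continuous seqT R 0 X).
rewrite actS (_ : (fun f : seqT => action H q.+1 f) =
    (fun f => action H q f + H (f q%:Z) (f (q%:Z + 1)))); last exact/funext.
exact: (@cvgD R R seqT (nbhs X) _ (fun f => action H q f)
  (fun f => H (f q%:Z) (f (q%:Z + 1))) _ _ IH (term q)).
Qed.

Section Cluster.
Context (p : int) (q : nat) (T : R) (X : seqT).
Context (q0 : (0 < q)%N) (p0 : 0 < p).
Context (pq : (wm < (p%:~R / q%:R : R)%:E < wp)%E).
Context (Tmin : forall x, pqS p q x -> T <= action H q x).
Context (clX : forall U d, nbhs X U -> 0 < d ->
  exists x, [/\ pqS p q x, U x & action H q x < T + d]).

Lemma cluster_step n e : 0 < e -> exists x, [/\ pqS p q x,
  `|x n - X n| < e & `|x (n + 1) - X (n + 1)| < e].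
Proof.
move=> e0; have [x [xS [x1 x2] _]] :=
  clX (filterI (nbhs_coord X n e0) (nbhs_coord X (n + 1) e0)) ltr01.
by exists x.
Qed.

Lemma cluster_mono n : X n <= X (n + 1).
Proof.
rewrite leNgt; apply/negP => lt.
have [|x [[x1 _ _]]] := @cluster_step n ((X n - X (n + 1)) / 2).
  by rewrite divr_gt0 // subr_gt0.
by have := x1 n; rewrite !ltr_norml; lra.
Qed.

Lemma cluster_period n : X (n + q%:Z) = X n + p%:~R.
Proof.
apply/eqP; rewrite -subr_eq0 -normr_le0 leNgt; apply/negP => gt0.
set e := `|_| in gt0; have e20 : 0 < e / 2 by rewrite divr_gt0.
have [x [[_ xq _] [x1 x2] _]] :=
  clX (filterI (nbhs_coord X n e20) (nbhs_coord X (n + q%:Z) e20)) ltr01.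
suff : e < e by rewrite ltxx.
rewrite {1}/e; have -> : X (n + q%:Z) - (X n + p%:~R) =
    (x n - X n) - (x (n + q%:Z) - X (n + q%:Z)) by rewrite xq; ring.
by rewrite (le_lt_trans (ler_normB _ _)) // [ltRHS]splitr ltrD.
Qed.

(** The strict bounds on the steps pass to the limit only as weak ones; strictness will need the
    behaviour of the momenta at the ends. *)
Lemma cluster_closed n :
  (wm <= (X (n + 1) - X n)%:E)%E /\ ((X (n + 1) - X n)%:E <= wp)%E.
Proof.
have near_step d : 0 < d -> exists x, pqS p q x /\
    `|(x (n + 1) - x n) - (X (n + 1) - X n)| < d.
  move=> d0; have [|x [xS x0 x1]] := @cluster_step n (d / 2); first exact: divr_gt0.
  exists x; split=> //; move: x0 x1; rewrite !ltr_norml; lra.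
split; rewrite leNgt; apply/negP => lt.
- have [d d0 dP] : exists2 d, 0 < d & forall s, `|s - (X (n + 1) - X n)| < d -> (s%:E < wm)%E.
    case: (wm) lt => [r||] //; last by exists 1 => // s _; rewrite ltry.
    rewrite lte_fin => lt; exists (r - (X (n + 1) - X n)); first by rewrite subr_gt0.
    by move=> s; rewrite ltr_norml lte_fin; lra.
  have [x [[_ _ xD] /dP lt1]] := near_step d d0.
  by have /andP[/lt_trans/(_ lt1)] := xD n; rewrite ltxx.
- have [d d0 dP] : exists2 d, 0 < d & forall s, `|s - (X (n + 1) - X n)| < d -> (wp < s%:E)%E.
    case: (wp) lt => [r||] //; last by exists 1 => // s _; rewrite ltNyr.
    rewrite lte_fin => lt; exists (X (n + 1) - X n - r); first by rewrite subr_gt0.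
    by move=> s; rewrite ltr_norml lte_fin; lra.
  have [x [[_ _ xD] /dP lt1]] := near_step d d0.
  by have /andP[_ /(lt_trans lt1)] := xD n; rewrite ltxx.
Qed.

(** The local improvement gains a fixed [d] on every sequence close to [X]. Applied to one of action
    below [T + d], it would bring the action below [T]. *)
Lemma cluster_stuck n sg m1 m2 e0 : (1 < q)%N ->
  sg = 1 \/ sg = -1 -> m1 < m2 -> 0 < e0 ->
  (forall e, 0 < e <= e0 ->
     [/\ X (n - 1) < X n + sg * e, X n + sg * e < X (n + 1),
         D (X (n - 1)) (X n + sg * e) & D (X n + sg * e) (X (n + 1))]) ->
  around2 (X (n - 1)) (X n) (fun x x' => D x x' -> sg * Y' x x' < m1) ->
  around2 (X n) (X (n + 1)) (fun x x' => D x x' -> m2 < sg * Y x x') ->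
  False.
Proof.
move=> q1 sgE m12 e00 De HY' HY.
have [e [d [a [d0 a0 imp]]]] := action_improve tw sgE m12 e00 De HY' HY.
have [x [xS [[xu xc] xv] xT]] :=
  clX (filterI (filterI (nbhs_coord X (n - 1) a0) (nbhs_coord X n a0))
               (nbhs_coord X (n + 1) a0)) d0.
have [_ _ xD] := xS; have := xD (n - 1); rewrite subrK => Dx.
have [le_e D1 D2 lt_e] := imp _ _ _ xu xc xv Dx (xD n).
have [z /Tmin zT zA] := pq_bump tw q1 xS le_e D1 D2.
lra.
Qed.

Lemma steps_not_constant r m :
  (forall k : nat, X (m + k%:Z + 1) - X (m + k%:Z) = r) -> r = p%:~R / q%:R.
Proof.
move=> Xr; have Xk (k : nat) : X (m + k%:Z) = X m + k%:R * r.
  elim: k => [|k IH]; first by rewrite addr0 mul0r addr0.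
  by rewrite -addn1 PoszD addrA -(subrK (X (m + k%:Z)) (X _)) Xr IH natrD; ring.
have q0' : (q%:R : R) != 0 by rewrite pnatr_eq0 -lt0n.
by have := cluster_period m; rewrite Xk => /addrI <-; rewrite mulrC mulKf.
Qed.

(** A run of steps of length r cannot go on forever: [q] of them would advance by [q r], which
    differs from [p]. *)
Lemma exists_last_step r m : r != p%:~R / q%:R -> X (m + 1) - X m = r ->
  exists n, X n - X (n - 1) = r /\ X (n + 1) - X n <> r.
Proof.
move=> rpq mr; have : ~ forall k : nat, X (m + k%:Z + 1) - X (m + k%:Z) = r.
  by move=> /steps_not_constant/eqP; rewrite (negbTE rpq).
move=> /existsNP[K nK].
have [||k [kr k1r]] := @exists_switch (fun k => X (m + k%:Z + 1) - X (m + k%:Z) = r) K.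
- by rewrite /= addr0.
- by [].
exists (m + k%:Z + 1); rewrite addrK; split=> //.
by move: k1r; rewrite -addn1 PoszD !addrA.
Qed.

(** With [q = 1] all steps equal [p]; excluding this case allows one point to move while its
    neighbours stay fixed. *)
Lemma last_step_gt1 r n : X n - X (n - 1) = r -> X (n + 1) - X n <> r -> (1 < q)%N.
Proof.
move=> nr; rewrite ltn_neqAle q0 andbT => n1r; apply/eqP => q1; apply: n1r.
have := cluster_period n; have := cluster_period (n - 1).
by rewrite -q1 subrK => E1 E2; rewrite -nr E1 E2 E1; ring.
Qed.

(* After a run of steps of maximal length wp, lowering the last point gains
   Y' - Y > 0 to first order, since Y' = b there while Y < b. *)
Lemma cluster_top n : ((X (n + 1) - X n)%:E < wp)%E.
Proof.
have [_] := cluster_closed n; rewrite le_eqVlt => /orP[/eqP/esym wpE|//]; exfalso.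
have [b [top1 top2]] := momentum_top tw wpE.
have [r rE] : exists r, X (n + 1) - X n = r by eexists.
rewrite rE in wpE top1 top2.
have pqr : p%:~R / q%:R < r by case/andP: pq => _; rewrite wpE lte_fin.
have pq0 : 0 < p%:~R / q%:R :> R by rewrite divr_gt0 ?ltr0z ?ltr0n.
have [k [kr k1r]] := @exists_last_step r n (negbT (gt_eqF pqr)) rE.
have k1lt : X (k + 1) - X k < r.
  rewrite lt_neqAle; apply/andP; split; first exact/eqP.
  by have [_] := cluster_closed k; rewrite wpE lee_fin.
have [wmk _] := cluster_closed k; have := cluster_mono k => kk1.
have [y yb /around2W Yy] := top1 _ _ wmk k1lt.
have XkE : X (k - 1) + r = X k by rewrite -kr; ring.
have /(top2 (X (k - 1))) Y'y : (y + b) / 2 < b by lra.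
rewrite XkE in Y'y.
(* The three bounds keep the shortened step at least [p / q], hence above [wm], keep it positive,
   and keep the lengthened next step below [r]. *)
pose e0 := Num.min (r - p%:~R / q%:R) (Num.min (r / 2) ((r - (X (k + 1) - X k)) / 2)).
apply: (@cluster_stuck k (-1) (- ((y + b) / 2)) (- y) e0).
- exact: last_step_gt1 kr k1r.
- by right.
- by lra.
- by rewrite !lt_min !subr_gt0 pqr !divr_gt0 ?subr_gt0 // (lt_trans pq0).
- move=> e /andP[e_gt0]; rewrite !le_min => /and3P[e1 e2 e3].
  rewrite !mulN1r; split; [lra|lra| |].
  + rewrite /gen_domain wpE lte_fin; apply/andP; split; last by lra.
    by case/andP: pq => + _; move/lt_le_trans; apply; rewrite lee_fin; lra.
  + rewrite /gen_domain wpE lte_fin; apply/andP; split; last by lra.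
    by apply: le_lt_trans wmk _; rewrite lte_fin; lra.
- apply: around2W Y'y => x x' h /h; lra.
- apply: Yy => x x' h /h; lra.
Qed.

(** After a run of steps of minimal length [wm], raising the last point lowers the action: [Y']
    tends to the lower end a there, while [Y] stays above some y > a. *)
Lemma cluster_bottom n : (wm < (X (n + 1) - X n)%:E)%E.
Proof.
have [+ _] := cluster_closed n; rewrite le_eqVlt => /orP[/eqP wmE|//]; exfalso.
have [a [bot1 bot2]] := momentum_bottom tw wmE.
have r0 : 0 <= X (n + 1) - X n by rewrite subr_ge0 cluster_mono.
have [r rE] : exists r, X (n + 1) - X n = r by eexists.
rewrite rE in wmE bot1 bot2 r0.
have pqr : r < p%:~R / q%:R by case/andP: pq; rewrite wmE lte_fin.
have [k [kr k1r]] := @exists_last_step r n (negbT (lt_eqF pqr)) rE.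
have k1lt : r < X (k + 1) - X k.
  rewrite lt_neqAle eq_sym; apply/andP; split; first exact/eqP.
  by have [] := cluster_closed k; rewrite wmE lee_fin.
have [_ wpk] := cluster_closed k.
have [y ay /around2W Yy] := bot1 _ _ k1lt wpk.
have XkE : X (k - 1) + r = X k by rewrite -kr; ring.
have /(bot2 (X (k - 1))) Y'y : a < (y + a) / 2 by lra.
rewrite XkE in Y'y.
(* The lengthened step stays at most [p / q], hence below [wp], and the shortened next one stays
   above [r], hence positive. *)
pose e0 := Num.min (p%:~R / q%:R - r) ((X (k + 1) - X k - r) / 2).
apply: (@cluster_stuck k 1 ((y + a) / 2) y e0).
- exact: last_step_gt1 kr k1r.
- by left.
- by lra.
- by rewrite !lt_min subr_gt0 pqr divr_gt0 // subr_gt0.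
- move=> e /andP[e_gt0]; rewrite !le_min => /andP[e1 e2].
  rewrite !mul1r; split; [lra|lra| |].
  + rewrite /gen_domain wmE lte_fin; apply/andP; split; first by lra.
    by case/andP: pq => _; apply: le_lt_trans; rewrite lee_fin; lra.
  + rewrite /gen_domain wmE lte_fin; apply/andP; split; first by lra.
    by apply: lt_le_trans wpk; rewrite lte_fin; lra.
- apply: around2W Y'y => x x' h /h; lra.
- apply: Yy => x x' h /h; lra.
Qed.

Lemma cluster_minimizer : is_minimizer wm wp H p q X.
Proof.
have XD n : D (X n) (X (n + 1)) by rewrite /gen_domain cluster_top cluster_bottom.
split; first by split=> n; [exact: cluster_mono|exact: cluster_period|].
move=> z zS; apply: (le_trans _ (Tmin zS)); rewrite leNgt; apply/negP => TX.
(* With half the gap, [T + d] equals [action H q X - d], so a sequence near [X] cannot have action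
   below [T + d]. *)
pose d := (action H q X - T) / 2; have d0 : 0 < d by rewrite divr_gt0 // subr_gt0.
have /cvgrPdist_lt/(_ d d0) nX := @action_seq_continuous q X XD.
have [x [_]] := @clX [set f : seqT | `|action H q X - action H q f| < d] d (nX (@nbhs_filter seqT X)) d0.
by rewrite /= ltr_norml /d; lra.
Qed.

End Cluster.

Lemma minimizer_exists p q : 0 < p -> (0 < q)%N ->
  (wm < (p%:~R / q%:R : R)%:E < wp)%E -> exists x, is_minimizer wm wp H p q x.
Proof.
move=> p0 q0 pq; have [T [X [TX clX]]] := cluster_minimizing tw (ltW p0) q0 pq.
by exists X; apply: (cluster_minimizer q0 p0 pq TX clX).
Qed.

End Attained.

(** * Crossing of minimizers and the strict decrease *)

Section Strictness.
Context {R : realType} {wm wp : \bar R} {H Y Y' : R -> R -> R}.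
Context (tw : twist_action wm wp H Y Y').
Local Notation D := (gen_domain wm wp).
Local Notation pqS := (pq_sequences wm wp).

(** At index [j q1 q2] the sequence x has advanced by [j q2 p] and y by [j q1 p]; hence x lies below
    y far to the left and above it far to the right. *)
Lemma exists_crossing p q1 q2 x y : 0 < p -> (0 < q1 < q2)%N ->
  pqS p q1 x -> pqS p q2 y ->
  exists n, x n <= y n /\ y (n + 1) < x (n + 1).
Proof.
move=> p0 /andP[q10 q12] xS yS.
pose J := Num.bound `|x 0 - y 0|.
have Jlt : `|x 0 - y 0| < J%:R by apply: archi_boundP.
have gap (j : int) : x (j * (q1 * q2)%:Z) - y (j * (q1 * q2)%:Z) =
    x 0 - y 0 + (j * (q2%:Z - q1%:Z) * p)%:~R.
  have -> : j * (q1 * q2)%:Z = 0 + (j * q2%:Z) * q1%:Z by rewrite PoszM; ring.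
  rewrite (pq_period _ _ xS).
  have -> : 0 + (j * q2%:Z) * q1%:Z = 0 + (j * q1%:Z) * q2%:Z by ring.
  rewrite (pq_period _ _ yS) !(rmorphM, rmorphB) /=; ring.
have Jp : J%:R <= (J%:Z * (q2%:Z - q1%:Z) * p)%:~R :> R.
  rewrite -[J%:R]/(J%:Z%:~R) ler_int -mulrA ler_peMr //.
  have q12' : 1 <= q2%:Z - q1%:Z by lia.
  by nia.
have [||k [kle knle]] := @exists_switch
    (fun i => x (- J%:Z * (q1 * q2)%:Z + i%:Z) <= y (- J%:Z * (q1 * q2)%:Z + i%:Z))
    (J * (q1 * q2) * 2)%N.
- rewrite /= addr0 -subr_le0 gap !mulNr mulrNz.
  by move: Jlt Jp; rewrite ltr_norml; lra.
- apply/negP; rewrite -ltNge.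
  have -> : - J%:Z * (q1 * q2)%:Z + (J * (q1 * q2) * 2)%N%:Z = J%:Z * (q1 * q2)%:Z.
    by rewrite !PoszM; ring.
  by rewrite -subr_gt0 gap; move: Jlt Jp; rewrite ltr_norml; lra.
exists (- J%:Z * (q1 * q2)%:Z + k%:Z); split=> //.
by move/negP: knle; rewrite -ltNge -addn1 PoszD addrA.
Qed.

Lemma action_strict p q x y : 0 < p ->
  is_minimizer wm wp H p q.+1 x -> is_minimizer wm wp H p q.+3 y ->
  exists z z', [/\ pqS p q.+2 z, pqS p q.+2 z' &
    action H q.+2 z + action H q.+2 z' < action H q.+1 x + action H q.+3 y].
Proof.
move=> p0 [xS xmin] ymin; have [yS _] := ymin.
have [|n [xyn yxn]] := exists_crossing p0 _ xS yS; first by rewrite ltnS leqW.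
have [fS fA] := pq_period_path (pq_shift n xS).
have [gS gA] := pq_period_path (pq_shift n yS).
have Hper := @action_periodic _ _ _ _ _ _ tw.
have [_ _ xD] := xS; have [y1 yq yD] := yS.
(* One path of doubled type suffices, since sorting splits it without raising the action. *)
suff [w wS wlt] : exists2 w, period_path wm wp (p + p) (q.+2 + q.+2) w &
    path_action H (q.+2 + q.+2) w < action H q.+1 x + action H q.+3 y.
  have [z [z' [zS zS' zle]]] := double_path_split tw wS.
  have [u [uS _ uE]] := period_path_pq (ltn0Sn q.+1) zS.
  have [u' [uS' _ uE']] := period_path_pq (ltn0Sn q.+1) zS'.
  by exists u, u'; split=> //; rewrite uE uE' (le_lt_trans zle).
have [||w [wS wg wf wA]] := period_path_merge tw fS gS; rewrite ?add0r //.
  by rewrite ![1 + n]addrC.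
move: wA wf; rewrite fA gA (pq_shift_action n Hper xS) (pq_shift_action n Hper yS) !add0r ![1 + n]addrC => wA wf.
have qE : (q.+1 + q.+3 = q.+2 + q.+2)%N by rewrite !addSn !addnS.
rewrite qE in wS wA.
move: xyn; rewrite le_eqVlt => /orP[/eqP xyn|xyn]; last first.
  exists w => //; have := action_exchange tw xyn yxn (xD n) (yD n); rewrite wA; lra.
have wA' : path_action H (q.+2 + q.+2) w = action H q.+1 x + action H q.+3 y.
  by rewrite wA xyn; ring.
pose P : R := p%:~R.
have DP u v : D u v -> D (u + P) (v + P).
  by move=> Duv; apply: (gen_domain_convex Duv Duv); lra.
have HP u v : D u v -> H (u + P) (v + P) = H u v by move=> Duv; rewrite Hper.
have yn : y (n - 1) < y n.
  by have := minimizer_increasing tw p0 (ltn0Sn _) ymin (n - 1); rewrite subrK.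
have cv : y n < x (n + 1) by apply: le_lt_trans yxn.
have Duc : D (y (n - 1)) (y n) by have := yD (n - 1); rewrite subrK.
have Dcv : D (y n) (x (n + 1)) by rewrite -xyn.
(* Minimality of y against lowering [y n] bounds [Y'] by [Y (y n) (y (n + 1))]; the twist and
   [y (n + 1) < x (n + 1)] make the slope at the joint strictly negative. *)
have gneg : 1 * (Y' (y (n - 1)) (y n) - Y (y n) (x (n + 1))) < 0.
  have := @minimizer_first_order _ _ _ _ _ _ tw p q.+3 y n (-1) isT ymin (or_intror (conj erefl yn)).
  by have := action_twist tw (yD n) Dcv yxn; lra.
have [|e [/andP[ue ev] D1 D2 lt_e]] :=
  action_improve_interior tw (or_introl (conj erefl cv)) _ Duc Dcv gneg.
  by rewrite !ltW.
(* In the joined path the common point sits at index [q.+2], translated by [p], between a point of y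
   and a point of x. *)
have w1 : w q.+1 = y (n - 1) + P.
  by rewrite (wg _ (leqnSn _)) -(yq (n - 1)); congr (y _); lia.
have w2 : w q.+2 = y n + P.
  by rewrite (wg _ (leqnn _)) -(yq n); congr (y _); lia.
have [||||w' wS' wA''] := @period_path_bump _ _ _ H _ _ w q.+1 e _ wS.
- by rewrite !addSn !addnS; lia.
- by rewrite w1 w2 wf; rewrite addrAC !lerD2r ue ev.
- by rewrite w1 w2 addrAC; exact: DP.
- by rewrite w2 wf addrAC; exact: DP.
exists w' => //; move: wA''; rewrite w1 w2 wf -/P [y n + P + e]addrAC.
rewrite (HP _ _ D1) (HP _ _ D2) (HP _ _ Duc) (HP _ _ Dcv) wA'.
by move: lt_e; clear - tw; lra.
Qed.

End Strictness.

(** * From the twist map and its generating function to the momenta *)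

Section TwistMapAction.
Context {R : realType} {a b wm wp : \bar R} {F : R * R -> R * R} {H : R -> R -> R}.
Context (hF : monotone_twist_map a b wm wp F) (hH : generating_function a b wm wp F H).
Local Notation D := (gen_domain wm wp).
Local Notation Y := (fun x x' => - derive1 (H^~ x') x).
Local Notation Y' := (fun x x' => derive1 (H x) x').

Lemma gen_domain_map x x' : D x x' ->
  strip a b (x, Y x x') /\ F (x, Y x x') = (x', Y' x x').
Proof.
by move=> Dx; have [_ gen _] := hH; apply/gen; split; rewrite ?opprK.
Qed.

Lemma strip_gen_domain x y : strip a b (x, y) ->
  D x (F (x, y)).1 /\ Y x (F (x, y)).1 = y.
Proof.
move=> xy; have [_ gen _] := hH.
have /gen[Dx -> _] : strip a b (x, y) /\ F (x, y) = ((F (x, y)).1, (F (x, y)).2).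
  by split=> //; rewrite -surjective_pairing.
by rewrite opprK.
Qed.

Lemma strip_diff z : strip a b z -> differentiable F z.
Proof. by have [_ [[[_ _ C1 _] _ _ _] _]] := hF => /C1[]. Qed.

Lemma map_fst_incr x y1 y2 : strip a b (x, y1) -> strip a b (x, y2) ->
  y1 < y2 -> (F (x, y1)).1 < (F (x, y2)).1.
Proof.
move=> s1 s2 y12; have [_ [[_ _ _ twist] _]] := hF.
have sy y : y1 <= y <= y2 -> strip a b (x, y).
  move=> /andP[y1y yy2]; case/andP: s1 => /= s1 _; case/andP: s2 => _ /= s2.
  by apply/andP; split; [apply: (lt_le_trans s1)|apply: (le_lt_trans _ s2)];
    rewrite lee_fin.
have [y|y] := @mvt_between R (fun s => (F (x, s)).1)
    (derive1 (fun s => (F (x, s)).1)) y1 y2.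
  rewrite (min_idPl (ltW y12)) (max_idPr (ltW y12)) => /sy/strip_diff dF.
  rewrite derive1E; apply: derivableP; apply/derivable1_diffP.
  apply: (@differentiable_comp _ _ _ _ (fun s : R => F (x, s)) fst) => //.
  apply: (@differentiable_comp _ _ _ _ (fun s : R => (x, s)) F) => //.
  by apply: linear_differentiable => z; exact: cvg_fst.
rewrite (min_idPl (ltW y12)) (max_idPr (ltW y12)) => /sy/twist dpos E.
by rewrite -subr_gt0 E mulr_gt0 // subr_gt0.
Qed.

Lemma map_continuous x y e : strip a b (x, y) -> 0 < e ->
  around2 x y (fun u v => `|(F (u, v)).1 - (F (x, y)).1| < e /\
                          `|(F (u, v)).2 - (F (x, y)).2| < e).
Proof.
move=> /strip_diff/differentiable_continuous cF e0.
have := cF _ (nbhsx_ballx (F (x, y)) e e0).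
move=> /around2_nbhs; apply: around2W => u v [/=].
by rewrite /ball /= distrC => -> ; rewrite distrC.
Qed.

(** [Y u u'] is the ordinate above u whose image has abscissa u', and images move right as the
    ordinate grows. An image of (u, y) left of u' therefore forces [y < Y u u'], and this comparison
    is open. The pair (x, x') may itself be a boundary step. *)
Lemma momentum_gt x x' y : strip a b (x, y) -> (F (x, y)).1 < x' ->
  around2 x x' (fun u u' => D u u' -> y < Y u u').
Proof.
move=> xy lt; have [|d d0 dF] := @map_continuous x y ((x' - (F (x, y)).1) / 2) xy.
  by rewrite divr_gt0 // subr_gt0.
exists (Num.min d ((x' - (F (x, y)).1) / 2)).
  by rewrite lt_min d0 divr_gt0 // subr_gt0.
move=> u u'; rewrite !lt_min => /andP[ud _] /andP[_ u'd] Du.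
have [|F1 _] := dF u y ud; first by rewrite subrr normr0.
have [su Fu] := gen_domain_map Du.
rewrite ltNge; apply/negP => Yy.
have suy : strip a b (u, y) by [].
have : (F (u, Y u u')).1 <= (F (u, y)).1.
  move: Yy; rewrite le_eqVlt => /orP[/eqP-> //|Yy].
  exact/ltW/map_fst_incr.
rewrite Fu /=; move: F1 u'd; rewrite !ltr_norml; clear - lt; lra.
Qed.

Lemma momentum_lt x x' y : strip a b (x, y) -> x' < (F (x, y)).1 ->
  around2 x x' (fun u u' => D u u' -> Y u u' < y).
Proof.
move=> xy lt; have [|d d0 dF] := @map_continuous x y (((F (x, y)).1 - x') / 2) xy.
  by rewrite divr_gt0 // subr_gt0.
exists (Num.min d (((F (x, y)).1 - x') / 2)).
  by rewrite lt_min d0 divr_gt0 // subr_gt0.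
move=> u u'; rewrite !lt_min => /andP[ud _] /andP[_ u'd] Du.
have [|F1 _] := dF u y ud; first by rewrite subrr normr0.
have [su Fu] := gen_domain_map Du.
rewrite ltNge; apply/negP => Yy.
have suy : strip a b (u, y) by [].
have : (F (u, y)).1 <= (F (u, Y u u')).1.
  move: Yy; rewrite le_eqVlt => /orP[/eqP<- //|Yy].
  exact/ltW/map_fst_incr.
rewrite Fu /=; move: F1 u'd; rewrite !ltr_norml; clear - lt; lra.
Qed.

Lemma strip_open x y e : strip a b (x, y) -> 0 < e ->
  exists2 d, 0 < d < e & strip a b (x, y - d) /\ strip a b (x, y + d).
Proof.
rewrite /strip /= => xy e0.
have : gen_domain a b 0 y by rewrite /gen_domain subr0.
move=> /gen_domain_open[d d0 dP]; exists (Num.min e d / 2).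
  have m0 : 0 < Num.min e d by rewrite lt_min e0 d0.
  by rewrite divr_gt0 //= ltr_pdivrMr // (@le_lt_trans _ _ e) ?ge_min ?lexx //; lra.
have ed : Num.min e d / 2 < d.
  by rewrite ltr_pdivrMr // (@le_lt_trans _ _ d) ?ge_min ?lexx ?orbT //; lra.
have m0 : 0 < Num.min e d / 2 by rewrite divr_gt0 // lt_min e0 d0.
have := dP 0 (y - Num.min e d / 2); have := dP 0 (y + Num.min e d / 2).
rewrite /gen_domain !subr0 normr0 => /(_ d0) h1 /(_ d0) h2; split; [apply: h2|apply: h1].
  by rewrite addrAC subrr add0r normrN gtr0_norm.
by rewrite addrAC subrr add0r gtr0_norm.
Qed.

(** [H] is only assumed differentiable, so continuity is drawn from the map: the images of the
    points at ordinates [Y x x' - d] and [Y x x' + d] stay on either side of x' under small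
    perturbations. *)
Lemma momentum1_continuous x x' e : D x x' -> 0 < e ->
  around2 x x' (fun u u' => D u u' -> `|Y u u' - Y x x'| < e).
Proof.
move=> Dx e0; have [sx Fx] := gen_domain_map Dx.
have [d /andP[d0 de] [sm sp]] := strip_open sx e0.
have gt : (F (x, Y x x' - d)).1 < x'.
  by have := map_fst_incr sm sx; rewrite Fx; apply; rewrite gtrBl.
have lt : x' < (F (x, Y x x' + d)).1.
  by have := map_fst_incr sx sp; rewrite Fx; apply; rewrite ltrDl.
have := around2I (momentum_gt sm gt) (momentum_lt sp lt).
apply: around2W => u u' [h1 h2] Du.
by move: (h1 Du) (h2 Du); rewrite ltr_norml; clear - de; lra.
Qed.

Lemma momentum2_continuous x x' e : D x x' -> 0 < e ->
  around2 x x' (fun u u' => D u u' -> `|Y' u u' - Y' x x'| < e).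
Proof.
move=> Dx e0; have [sx Fx] := gen_domain_map Dx.
have [d d0 dF] := map_continuous sx e0.
have [c c0 cY] := momentum1_continuous Dx d0.
exists (Num.min c d); first by rewrite lt_min c0 d0.
move=> u u'; rewrite !lt_min => /andP[uc ud] /andP[u'c _] Du.
have [_] := dF u (Y u u') ud (cY _ _ uc u'c Du).
by have [_ ->] := gen_domain_map Du; rewrite Fx.
Qed.

Lemma strip_near_top x y b0 : b = b0%:E -> y < b0 ->
  exists2 z, y < z < b0 & strip a b (x, z).
Proof.
move=> bE yb; have [ab _] := hF; rewrite bE in ab.
have [m [ym mb am]] : exists m, [/\ y <= m, m < b0 & (a <= m%:E)%E].
  case: (a) ab => [a0|//|_]; last by exists y; rewrite leNye.
  rewrite lte_fin => ab; exists (Num.max y a0).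
  by rewrite le_max lexx gt_max yb ab lee_fin le_max lexx orbT.
exists ((m + b0) / 2); first by clear - hF ym mb; lra.
rewrite /strip /= bE lte_fin; apply/andP; split; last by clear - hF mb; lra.
by apply: le_lt_trans am _; rewrite lte_fin; clear - hF mb; lra.
Qed.

Lemma strip_near_bottom x y a0 : a = a0%:E -> a0 < y ->
  exists2 z, a0 < z < y & strip a b (x, z).
Proof.
move=> aE ay; have [ab _] := hF; rewrite aE in ab.
have [m [my am mb]] : exists m, [/\ m <= y, a0 < m & (m%:E <= b)%E].
  case: (b) ab => [b0|_|//]; last by exists y; rewrite leey.
  rewrite lte_fin => ab; exists (Num.min y b0).
  by rewrite ge_min lexx lt_min ay ab lee_fin ge_min lexx orbT.
exists ((m + a0) / 2); first by clear - hF my am; lra.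
rewrite /strip /= aE lte_fin; apply/andP; split; first by clear - hF am; lra.
by apply: lt_le_trans mb; rewrite lte_fin; clear - hF am; lra.
Qed.

(** A step shorter than [r] is outrun by the image of some point of the strip, whose ordinate bounds
    [Y] away from the top. Near a step of length [r] the ordinate [Y] is close to the top, and the
    boundary shift carries this over to [Y']. *)
Lemma momentum_top_end r : wp = r%:E -> exists b0,
  (forall x x', (wm <= (x' - x)%:E)%E -> x' - x < r -> exists2 y, y < b0 &
     around2 x x' (fun u u' => D u u' -> Y u u' < y)) /\
  (forall x y, y < b0 ->
     around2 x (x + r) (fun u u' => D u u' -> y < Y' u u')).
Proof.
(* A finite [wp] forces [b] to be finite, the default value being [+oo]. *)
move=> wpE; have [b0 [bE Fb]] : exists b0, b = b0%:E /\
    forall x, F z @[z --> within (strip a b) (nbhs (x, b0))] --> (x + r, b0).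
  have [_ [_ [_]]] := hF; rewrite /boundary_shift wpE.
  case: (b) => [b0| |] // [_ [<-] Fb]; by exists b0.
exists b0; split.
- move=> x x'; rewrite le_eqVlt => /orP[/eqP wmE xr|wmx xr].
    (* For a step of length [wm] any point of the strip will do, as its image advances by more than
       [wm]; [b0 - 1] is arbitrary. *)
    have [y /andP[_ yb] sy] := strip_near_top x bE (ltac:(by rewrite gtrBl) : b0 - 1 < b0).
    exists y => //; apply: (momentum_lt sy).
    have [/andP[+ _] _] := strip_gen_domain sy.
    by rewrite wmE lte_fin ltrD2r.
  have Dx : D x x' by rewrite /gen_domain wmx wpE lte_fin.
  have [sx Fx] := gen_domain_map Dx.
  have Yb : Y x x' < b0 by case/andP: (sx) => _; rewrite bE lte_fin.
  have [y /andP[Yy yb] sy] := strip_near_top x bE Yb.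
  exists y => //; apply: (momentum_lt sy).
  by have := map_fst_incr sx sy Yy; rewrite Fx.
- move=> x y yb.
  have : nbhs (x + r, b0) [set w : R * R | y < w.2].
    exists (setT, [set v | y < v]); last by move=> [u v] [_].
    by split; [exact: filterT|exact: lt_nbhsr].
  move=> /(Fb x); rewrite /within /= => /around2_nbhs[d d0 dF].
  (* [Y u u'] will lie between this [z] and [b0], hence close enough to [b0] for the boundary
     extension. *)
  have [z /andP[zd zb] sz] := strip_near_top x bE (ltac:(by rewrite gtrBl) : b0 - d < b0).
  have lt : (F (x, z)).1 < x + r.
    have [/andP[_ +] _] := strip_gen_domain sz.
    by rewrite wpE lte_fin ltrBlDl.
  have [c c0 cY] := momentum_gt sz lt.
  exists (Num.min c d); first by rewrite lt_min c0 d0.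
  move=> u u'; rewrite !lt_min => /andP[uc ud] /andP[u'c _] Du.
  have [su Fu] := gen_domain_map Du; have zY := cY u u' uc u'c Du.
  have Yb : Y u u' < b0 by case/andP: (su) => _; rewrite bE lte_fin.
  have Yd : `|Y u u' - b0| < d by rewrite ltr_norml; clear - hF zd zY Yb; lra.
  have yF : y < (F (u, Y u u')).2 := dF u (Y u u') ud Yd su.
  by rewrite Fu in yF.
Qed.

Lemma momentum_bottom_end r : wm = r%:E -> exists a0,
  (forall x x', r < x' - x -> ((x' - x)%:E <= wp)%E -> exists2 y, a0 < y &
     around2 x x' (fun u u' => D u u' -> y < Y u u')) /\
  (forall x y, a0 < y ->
     around2 x (x + r) (fun u u' => D u u' -> Y' u u' < y)).
Proof.
move=> wmE; have [a0 [aE Fa]] : exists a0, a = a0%:E /\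
    forall x, F z @[z --> within (strip a b) (nbhs (x, a0))] --> (x + r, a0).
  have [_ [_ [+ _]]] := hF; rewrite /boundary_shift wmE.
  case: (a) => [a0| |] // [_ [<-] Fa]; by exists a0.
exists a0; split.
- move=> x x' + xwp; move: xwp; rewrite le_eqVlt => /orP[/eqP wpE xr|xwp xr].
    have [y /andP[ay _] sy] := strip_near_bottom x aE (ltac:(by rewrite ltrDl) : a0 < a0 + 1).
    exists y => //; apply: (momentum_gt sy).
    have [/andP[_ +] _] := strip_gen_domain sy.
    by rewrite -wpE lte_fin ltrD2r.
  have Dx : D x x' by rewrite /gen_domain xwp wmE lte_fin xr.
  have [sx Fx] := gen_domain_map Dx.
  have Ya : a0 < Y x x' by case/andP: (sx); rewrite aE lte_fin.
  have [y /andP[ay yY] sy] := strip_near_bottom x aE Ya.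
  exists y => //; apply: (momentum_gt sy).
  by have := map_fst_incr sy sx yY; rewrite Fx.
- move=> x y ay.
  have : nbhs (x + r, a0) [set w : R * R | w.2 < y].
    exists (setT, [set v | v < y]); last by move=> [u v] [_].
    by split; [exact: filterT|exact: lt_nbhsl].
  move=> /(Fa x); rewrite /within /= => /around2_nbhs[d d0 dF].
  have [z /andP[az zd] sz] := strip_near_bottom x aE (ltac:(by rewrite ltrDl) : a0 < a0 + d).
  have gt : x + r < (F (x, z)).1.
    have [/andP[+ _] _] := strip_gen_domain sz.
    by rewrite wmE lte_fin ltrBrDl.
  have [c c0 cY] := momentum_lt sz gt.
  exists (Num.min c d); first by rewrite lt_min c0 d0.
  move=> u u'; rewrite !lt_min => /andP[uc ud] /andP[u'c _] Du.
  have [su Fu] := gen_domain_map Du; have Yz := cY u u' uc u'c Du.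
  have Ya : a0 < Y u u' by case/andP: (su); rewrite aE lte_fin.
  have Yd : `|Y u u' - a0| < d by rewrite ltr_norml; clear - hF zd Yz Ya; lra.
  have Fy : (F (u, Y u u')).2 < y := dF u (Y u u') ud Yd su.
  by rewrite Fu in Fy.
Qed.

Lemma derivable_partial x x' : D x x' ->
  derivable (H^~ x') x 1 /\ derivable (H x) x' 1.
Proof.
move=> Dx; have [dH _ _] := hH; have := dH _ _ Dx => dHx.
split; apply/derivable1_diffP.
  by apply: (@differentiable_comp _ _ _ _ (fun s : R => (s, x')) (fun z => H z.1 z.2)).
by apply: (@differentiable_comp _ _ _ _ (fun s : R => (x, s)) (fun z => H z.1 z.2)).
Qed.

Lemma twist_map_action : twist_action wm wp H Y Y'.
Proof.
split.
- move=> x x' Dx; rewrite opprK derive1E; apply: derivableP.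
  exact: (derivable_partial Dx).1.
- move=> x x' Dx; rewrite derive1E; apply: derivableP.
  exact: (derivable_partial Dx).2.
- move=> x x' Dx; have [dH _ _] := hH.
  exact: (differentiable_continuous (dH _ _ Dx)).
- by have [] := hH.
- move=> x x1 x2 D1 D2 x12.
  have [s1 F1] := gen_domain_map D1; have [s2 F2] := gen_domain_map D2.
  rewrite ltNge; apply/negP; rewrite le_eqVlt => /orP[/eqP Y12|/(map_fst_incr s2 s1)].
    by move: x12; have := congr1 fst F1; rewrite /= -Y12 F2 /= => ->; rewrite ltxx.
  by rewrite F1 F2 /= ltNge (ltW x12).
- exact: momentum1_continuous.
- exact: momentum2_continuous.
- exact: momentum_top_end.
- exact: momentum_bottom_end.
Qed.

End TwistMapAction.

(** * Mean step length and the inequality with possibly infinite values *)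

Lemma pq_rotation_number {R : realType} {wm wp : \bar R} (p : int) (q : nat) (x : int -> R) :
  (0 < q)%N -> pq_sequences wm wp p q x ->
  (wm < (p%:~R / q%:R : R)%:E < wp)%E.
Proof.
move=> q0 [_ xq xD]; have q0' : 0 < (q%:R : R) by rewrite ltr0n.
(* The steps of one period telescope to [p], so their mean [p / q] inherits their strict bounds. *)
have sumE : \sum_(i < q) (x (i%:Z + 1) - x i%:Z) = p%:~R.
  rewrite -(big_mkord xpredT (fun i => x (i%:Z + 1) - x i%:Z)).
  under eq_bigr do rewrite -PoszD addn1.
  by rewrite (telescope_sumr (fun i : nat => x i%:Z)) // -[q%:Z]add0r xq addrAC subrr add0r.
have constE r : \sum_(i < q) r = r * q%:R :> R.
  by rewrite sumr_const card_ord mulr_natr.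
apply/andP; split.
- have := fun n => (andP (xD n)).1; case: (wm) => [r| |] h.
  + rewrite lte_fin ltr_pdivlMr // -constE -sumE ltr_sum => [//||i _].
      by apply/hasP; exists (Ordinal q0); rewrite ?mem_index_enum.
    by rewrite -lte_fin.
  + by have := h 0.
  + exact: ltNyr.
- have := fun n => (andP (xD n)).2; case: (wp) => [r| |] h.
  + rewrite lte_fin ltr_pdivrMr // -constE -sumE ltr_sum => [//||i _].
      by apply/hasP; exists (Ordinal q0); rewrite ?mem_index_enum.
    by rewrite -lte_fin.
  + exact: ltry.
  + by have := h 0.
Qed.

Theorem lemma2p1 (R : realType) (a b wm wp : \bar R)
    (F : R * R -> R * R) (H : R -> R -> R)
    (hF : monotone_twist_map a b wm wp F)
    (hH : generating_function a b wm wp F H)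
    (p : int) (q : nat) (q_gt0 : (0 < q)%N)
    (pq_coprime : coprimez p q%:Z)
    (pq_twist : (wm < (p%:~R / q%:R : R)%:E < wp)%E)
    (q_neq1 : q <> 1%N)
    (pq_nonempty : pq_sequences wm wp p q !=set0) :
  (min_action wm wp H p q.-1 + min_action wm wp H p q.+1
     > 2%:E * min_action wm wp H p q)%E.
Proof.
have tw := twist_map_action hF hH.
have [x0 x0S] := pq_nonempty.
case: q q_gt0 pq_coprime pq_twist q_neq1 x0S {pq_nonempty} => [//|[//|q]] _ pq_co _ _ x0S.
(* Monotone sequences of this type exist, so [p] is nonnegative; it is nonzero because it is prime
   to a period of at least 2. *)
have p0 : 0 < p.
  rewrite lt_neqAle; apply/andP; split.
    apply/eqP => p0; move: pq_co; rewrite -p0 /coprimez gcd0z; lia.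
  have [_ xq _] := x0S; have : x0 0 <= x0 (0 + q.+2%:Z) by apply: (pq_mono x0S); lia.
  by rewrite xq lerDl ler0z.
(* Types with neighbouring periods may admit no sequence; otherwise [p / k.+1] lies in the twist
   interval and a minimizer exists. *)
have minE k : min_action wm wp H p k.+1 = +oo%E \/
    exists2 x, is_minimizer wm wp H p k.+1 x &
      min_action wm wp H p k.+1 = (action H k.+1 x)%:E.
  have [[x xS]|/set0P/negP/negPn/eqP S0] := pselect (pq_sequences wm wp p k.+1 !=set0).
    have [y ymin] := minimizer_exists tw p0 (ltn0Sn k) (pq_rotation_number (ltn0Sn k) xS).
    by right; exists y => //; case: ymin => yS ymin; apply: min_actionE.
  by left; rewrite /min_action S0 image_set0 ereal_inf0.
have minle k z : pq_sequences wm wp p k z -> (min_action wm wp H p k <= (action H k z)%:E)%E.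
  by move=> zS; apply: ereal_inf_lbound; exists z.
have [T2|[x xmin T2]] := minE q.+1.
  by have := minle _ _ x0S; rewrite T2 leye_eq.
have lty : (2%:E * (action H q.+2 x)%:E < +oo)%E by rewrite -EFinM ltry.
(* If one neighbouring value is [+oo], so is the left side, while the right side is finite. Periods
   are offset by one: [minE q] concerns [q.+1]. *)
rewrite T2 /=; have [->|[y ymin ->]] := minE q; have [->|[z zmin ->]] := minE q.+2 => //.
have [u [v [uS vS lt]]] := action_strict tw p0 ymin zmin.
have := minle _ _ uS; have := minle _ _ vS; rewrite T2 -EFinM -EFinD lte_fin !lee_fin.
lra.
Qed.
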